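(* Let $\alpha>0$, let $\sigma$ be a finite Borel measure on the unit sphere $S\subset\mathbb{R}^d$, and let $\xi,\xi_1,\xi_2,\ldots$ be i.i.d. $\mathbb{R}^d$-valued random vectors such that for all $\rho>0$ and all Borel sets $B\subset S$ with $\sigma(\partial B)=0$, $$\lim_{n\to\infty} n\,\mathbf{P}\left\{\frac{\xi}{\|\xi\|}\in B,\ \|\xi\|>\rho\, n^{1/\alpha}\right\}=\sigma(B)\rho^{-\alpha}.$$ Let $r\in(0,1)$, and for each sample size $N$ let $n=[N^r]$ and $m=[N/n]$. Then for every $t$ with $0<t<\frac{\alpha r}{2}$, $$\widehat{\sigma(S)}_N-\sigma(S)\longrightarrow 0\quad\text{almost surely as } N\to\infty,$$ where $$\widehat{\sigma(S)}_N=\left(\frac{1}{n\,\Gamma(1-\frac{t}{\alpha})}\sum_{i=1}^n q_{m,i}^t\right)^{\alpha/t}.$$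
   Context: $\|\cdot\|$ is the Euclidean norm on $\mathbb{R}^d$, $S=\{x\in\mathbb{R}^d:\|x\|=1\}$, $\partial B$ is the boundary of $B$ in $S$, $[a]$ is the integer part of $a$, and $\Gamma(\cdot)$ is the Gamma function. The sample $\xi_1,\ldots,\xi_N$ is divided into $n$ disjoint groups $G_{m,1},\ldots,G_{m,n}$ of $m$ vectors each (e.g. $G_{m,i}=\{\xi_{(i-1)m+1},\ldots,\xi_{im}\}$; leftover vectors are discarded). Define $$M^{(1)}_{m,i}=\max\{\|\zeta\| : \zeta\in G_{m,i}\},\qquad q_{m,i}=\frac{M^{(1)}_{m,i}}{m^{1/\alpha}},\qquad i=1,\ldots,n.$$ *)

(* Defs.v *)
From HB Require Import structures.
From mathcomp Require Import all_boot all_order all_algebra finmap.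
From mathcomp Require Import all_classical all_reals all_analysis.

Set Implicit Arguments.
Unset Strict Implicit.
Unset Printing Implicit Defensive.

Import Order.TTheory GRing.Theory Num.Theory.
Import numFieldNormedType.Exports.

Local Open Scope classical_set_scope.
Local Open Scope ring_scope.

(* The library norm on matrices is the sup norm. It induces the Euclidean
   topology, so [open], [closure] and the Borel sets need no redefinition. *)
Definition enorm (R : realType) (d : nat) (x : 'rV[R]_d) : R :=
  Num.sqrt (\sum_(i < d) x ord0 i ^+ 2).

(* The dimension is d.+1 since measurable types must be inhabited and the unit
   sphere of R^0 is empty. *)
Definition usphere (R : realType) (d : nat) : Type :=
  set_type [set x : 'rV[R]_d.+1 | enorm x = 1].

Lemma enorm_delta0 (R : realType) (d : nat) :
  enorm (delta_mx ord0 ord0 : 'rV[R]_d.+1) = 1.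
Proof.
rewrite /enorm big_ord_recl big1 ?addr0; last first.
  by move=> i _; rewrite mxE /= expr0n.
by rewrite mxE !eqxx /= expr1n sqrtr1.
Qed.

(* The topology is the one induced by R^d.+1. *)
HB.instance Definition _ (R : realType) (d : nat) :=
  Topological.copy (usphere R d)
    (set_type [set x : 'rV[R]_d.+1 | enorm x = 1]).
HB.instance Definition _ (R : realType) (d : nat) :=
  isPointed.Build (usphere R d)
    (exist _ (delta_mx ord0 ord0) (mem_set (@enorm_delta0 R d))).

Notation borel T := (g_sigma_algebraType (@open T)).

Definition boundary (T : topologicalType) (B : set T) : set T :=
  closure B `\` B°.

Section probability.
Context d d' (Omega : measurableType d) (E : measurableType d') (R : realType).
Variable P : probability Omega R.

Definition mutually_independent (I : choiceType) (X : I -> {RV P >-> E}) :=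
  forall (J : {fset I}) (B : I -> set E),
    (forall j, measurable (B j)) ->
    P (\bigcap_(j in [set` J]) (X j @^-1` B j)) =
      (\prod_(j <- J) P (X j @^-1` B j))%E.

Definition identically_distributed (I : Type) (X : I -> {RV P >-> E}) :=
  forall (i j : I) (B : set E),
    measurable B -> distribution P (X i) B = distribution P (X j) B.

Definition iid (I : choiceType) (X : I -> {RV P >-> E}) :=
  mutually_independent X /\ identically_distributed X.

End probability.

(* When xi w = 0 the direction is the junk value 0, but the strict inequality
   on the norm excludes such w. *)
Definition regularly_varying_tail d0 (Omega : measurableType d0) (R : realType)
    (P : probability Omega R) (d : nat) (xi : Omega -> 'rV[R]_d.+1)
    (alpha : R) (sigma : set (usphere R d) -> \bar R) :=
  forall (rho : R) (B : set (borel (usphere R d))),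
    0 < rho -> measurable B -> sigma (boundary (B : set (usphere R d))) = 0%E ->
    (fun n : nat => n%:R%:E *
       P [set w | ((fun s : usphere R d => set_val s) @` B)
                    ((enorm (xi w))^-1 *: xi w) /\
                  (rho * n%:R `^ alpha^-1 < enorm (xi w))%R])%E @ \oo -->
    (sigma B * (rho `^ (- alpha))%:E)%E.

Definition Gamma (R : realType) (s : R) : R :=
  \int[lebesgue_measure]_(x in `]0, +oo[) (x `^ (s - 1) * expR (- x)).

Definition group_count (R : realType) (r : R) (N : nat) : nat :=
  Num.truncn (N%:R `^ r : R).

Definition group_size (R : realType) (r : R) (N : nat) : nat :=
  N %/ group_count r N.

(* An element k : 'I_N of a group stands for the sample vector of index k + 1. *)
Definition is_grouping (N n m : nat) (G : 'I_n -> {set 'I_N}) :=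
  (forall i, #|G i| = m) /\ (forall i j k, k \in G i -> k \in G j -> i = j).

Definition group_max (R : realType) (d N n : nat) (x : nat -> 'rV[R]_d)
    (G : 'I_n -> {set 'I_N}) (i : 'I_n) : R :=
  \big[Num.max/0]_(k in G i) enorm (x k.+1).

Definition sigma_hat (R : realType) (d N n m : nat) (alpha t : R)
    (x : nat -> 'rV[R]_d) (G : 'I_n -> {set 'I_N}) : R :=
  ((n%:R * Gamma (1 - t / alpha))^-1 *
   \sum_(i < n) (group_max x G i / m%:R `^ alpha^-1) `^ t) `^ (alpha / t).

(* Main.v *)
Require Import Defs.
From HB Require Import structures.
From mathcomp Require Import all_boot all_order all_algebra finmap.
From mathcomp Require Import all_classical all_reals all_analysis.
From mathcomp Require Import measurable_realfun ring lra.

Import Order.TTheory GRing.Theory Num.Theory.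
Import numFieldNormedType.Exports.

Local Open Scope classical_set_scope.
Local Open Scope ring_scope.

(** Put s = t / alpha and c = sigma(S). The maxima of the groups are independent,
and the tail condition with B = S gives q_{m,i}^t > z with probability tending
to 1 - exp(- c z^(-1/s)), uniformly dominated by a multiple of z^(-1/s). Hence the
mean of q_{m,i}^t converges to the integral of this limit over z > 0, which is
c^s Gamma(1 - s) by Tonelli, and the theorem reduces to showing that the average
of the q_{m,i}^t is almost surely close to that mean.

Truncate q_{m,i}^t at the level L = N^b. Some truncation occurs with probability
at most n C L^(-1/s), which is of order N^(r - b/s), while an exponential Markov
inequality with parameter N^(-a), b < a < r, bounds the deviation of the
truncated average by exp(- const N^(r - a)). Both bounds are summable in N when
s(1 + r) < b, and s(1 + r) < r because s < r/2 and r < 1; the Borel-Cantelli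
lemma concludes. *)

Set Implicit Arguments.
Unset Strict Implicit.
Unset Printing Implicit Defensive.

(** The number of groups, their size and their composition all change with N, so the averages form a
    triangular array: the strong law for a single sequence does not apply, and no monotonicity
    allows passing through a subsequence. The bad events must therefore be summable over every N.
    Chebyshev's inequality would only give a bound of order 1/n, about N^(-r), whose series diverges
    because r < 1; hence an exponential inequality, and hence the truncation, since q^t is only
    known to have a power tail. The exponents are forced as follows: r - b/s < -1 is b > s(1 + r); b
    < a makes N^(-a) L tend to 0, so that the quadratic term of the exponential moment is
    negligible; a < r makes N^(r - a) grow. Independence enters only through joint distribution
    functions, so a separate argument recovers from them the expectations of products. The case
    sigma(S) = 0 is allowed and needs care wherever a power of c appears. *)

(** * Measurability and elementary inequalities *)

Lemma measurable_set_bool d (T : measurableType d) (b : T -> bool) :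
  measurable_fun setT b -> measurable [set x | b x].
Proof.
by move=> /(_ measurableT [set true] I); rewrite setTI; apply.
Qed.

Lemma measurable_lt_fun d (T : measurableType d) (R : realType) (f g : T -> R) :
  measurable_fun setT f -> measurable_fun setT g -> measurable [set x | f x < g x].
Proof. by move=> mf mg; apply: measurable_set_bool; exact: measurable_fun_ltr. Qed.

Lemma measurable_le_fun d (T : measurableType d) (R : realType) (f g : T -> R) :
  measurable_fun setT f -> measurable_fun setT g -> measurable [set x | f x <= g x].
Proof. by move=> mf mg; apply: measurable_set_bool; exact: measurable_fun_ler. Qed.

Lemma bounded_integral_fin_num d (T : measurableType d) (R : realType)
    (P : probability T R) (h : T -> R) (B : R) :
    measurable_fun setT h -> (forall x, 0 <= h x <= B) ->
  (\int[P]_x (h x)%:E)%E \is a fin_num.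
Proof.
move=> mh hB; rewrite ge0_fin_numE; last first.
  by apply: integral_ge0 => x _; rewrite lee_fin; have /andP[] := hB x.
apply: le_lt_trans (_ : \int[P]_x (cst B%:E x) < +oo)%E.
  apply: ge0_le_integral => //=.
  - by move=> x _; rewrite lee_fin; have /andP[] := hB x.
  - exact/measurable_EFinP.
  - by move=> x _; rewrite lee_fin; have /andP[] := hB x.
by rewrite integral_cst//= probability_setT mule1 ltry.
Qed.

Lemma gt0_powR_le (R : realType) (q u v : R) : 0 < q -> 0 <= u -> 0 <= v ->
  (u `^ q <= v `^ q) = (u <= v).
Proof.
move=> q0 u0 v0; apply/idP/idP; last exact: (ge0_ler_powR (ltW q0)).
by rewrite !leNgt; apply: contra; exact: (gt0_ltr_powR q0).
Qed.

Lemma onem_expn_itv01 (R : realType) (u : R) (k : nat) :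
  0 <= u <= 1 -> 0 <= 1 - (1 - u) ^+ k <= 1.
Proof.
move=> /andP[u0 u1].
by rewrite subr_ge0 gerBl exprn_ge0 ?subr_ge0// exprn_ile1 ?subr_ge0// gerBl.
Qed.

(** * Expectations of products of independent variables *)

Section weighted_distribution.
Context d0 (Omega : measurableType d0) (R : realType) (P : probability Omega R).
Context (g X : Omega -> R).
Hypothesis mg : measurable_fun setT g.
Hypothesis g_ge0 : forall w, 0 <= g w.
Hypothesis mX : measurable_fun setT X.

Let nu (A : set R) : \bar R :=
  (\int[P]_(w in X @^-1` A) (g w)%:E)%E.

Let mpreimage (A : set R) :
  measurable A -> measurable (X @^-1` A).
Proof. by move=> mA; rewrite -(setTI (_ @^-1` _)); exact: mX. Qed.

Let nu0 : nu set0 = 0%E.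
Proof. by rewrite /nu preimage_set0 integral_set0. Qed.

Let nu_ge0 A : (0 <= nu A)%E.
Proof. by apply: integral_ge0 => w _; rewrite lee_fin. Qed.

Let nu_sigma_additive : semi_sigma_additive nu.
Proof.
move=> /= F mF tF mUF; rewrite /nu; apply: cvg_toP.
  apply: ereal_nondecreasing_is_cvgn => m n mn.
  apply: lee_sum_nneg_natr => // k _ _; apply: integral_ge0 => w _.
  by rewrite lee_fin.
rewrite preimage_bigcup ge0_integral_bigcup//=.
- by move=> k; exact: mpreimage.
- apply/measurable_EFinP; exact: measurable_funTS.
- by move=> w _; rewrite lee_fin.
- by move=> i j _ _ [w [Fi Fj]]; apply: tF => //; exists (X w).
Qed.

HB.instance Definition _ := isMeasure.Build _ _ _ nu
  nu0 nu_ge0 nu_sigma_additive.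

(** Closed lower rays form a pi-system that generates the Borel sets, and the [g]-weighted law of
    [X] is finite. It therefore coincides with [K] times the law of [X] as soon as the two agree on
    rays, which is all that distribution functions provide. *)
Lemma weighted_distribution_unique (K : R) : 0 <= K ->
    (\int[P]_w (g w)%:E < +oo)%E ->
    (forall y : R, \int[P]_(w in [set w | (X w <= y)%R]) (g w)%:E =
      K%:E * P [set w | (X w <= y)%R])%E ->
  forall A : set R, measurable A ->
    (\int[P]_(w in X @^-1` A) (g w)%:E = K%:E * P (X @^-1` A))%E.
Proof.
move=> K0 gfin H A mA.
pose mX_mixin := isMeasurableFun.Build _ _ _ _ _ mX.
pose mX_pack : {mfun Omega >-> R} := HB.pack X mX_mixin.
pose G : set (set R) := [set A | exists x, A = `]-oo, x]%classic].
(* Closed lower rays are the complements of open upper rays, so both families generate the same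
   sigma-algebra. *)
have GE : @measurable _ R = <<s G >>.
  transitivity <<s @RGenOInfty.G R >>; first exact: (RGenOInfty.measurableE R).
  apply/seteqP; split => B.
    apply: smallest_sub; first exact: smallest_sigma_algebra.
    move=> _ [x ->]; rewrite -setCitvl.
    apply: (@measurableC _ (g_sigma_algebraType G)).
    by apply: sub_sigma_algebra; exists x.
  apply: smallest_sub; first exact: smallest_sigma_algebra.
  move=> _ [x ->]; rewrite -setCitvr; apply: (@measurableC _ (g_sigma_algebraType _)).
  by apply: sub_sigma_algebra; exists x.
apply: (@measure_unique _ _ R G (fun n => `]-oo, n%:R]%classic) GE _ _ _ nu
  (mscale (NngNum K0) (pushforward P mX_pack))) => //.
- move=> _ _ [x ->] [y ->]; exists (Num.min x y).
  by apply/seteqP; split => z /=; rewrite !in_itv/= le_min => /andP.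
- by move=> i; exists i%:R.
- apply/seteqP; split => // x _; exists (Num.truncn x).+1 => //=.
  by rewrite in_itv/= ltW// truncnS_gt.
- by move=> _ [x ->]; rewrite /nu/= /mscale/= /pushforward/= set_itvNyc; exact: (H x).
- move=> k; apply: le_lt_trans gfin; rewrite /nu/=.
  apply: ge0_subset_integral => //.
  + by apply: mpreimage.
  + exact/measurable_EFinP.
  + by move=> w _; rewrite lee_fin.
Qed.

End weighted_distribution.

(** [h w] is the length of the interval from 0 to [h w]; Tonelli on the region below the graph of
    [h] exchanges the integrals, and the weight [g] is carried along. *)
Lemma integral_layer_cake d0 (Omega : measurableType d0) (R : realType)
    (P : probability Omega R) (g h : Omega -> R) :
    measurable_fun setT g -> (forall w, 0 <= g w) ->
    measurable_fun setT h -> (forall w, 0 <= h w) ->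
  (\int[P]_w (g w * h w)%:E = \int[lebesgue_measure]_(z in `[0%R, +oo[)
     \int[P]_(w in [set w | (z < h w)%R]) (g w)%:E)%E.
Proof.
move=> mg g0 mh h0.
pose A := [set p : Omega * measurableTypeR R | 0 <= p.2 < h p.1].
pose F (p : Omega * measurableTypeR R) : \bar R := (g p.1 * \1_A p)%:E.
have mF : measurable_fun setT F.
  apply/measurable_EFinP/measurable_funM; first exact: measurableT_comp.
  apply: measurable_indic; apply: measurable_set_bool; apply: measurable_and.
    exact: measurable_fun_ler.
  by apply: measurable_fun_ltr => //; exact: measurableT_comp.
have F0 p : (0 <= F p)%E by rewrite lee_fin mulr_ge0.
transitivity (\int[P]_w \int[lebesgue_measure]_z F (w, z))%E.
  apply: eq_integral => w _; rewrite /F/=.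
  under eq_integral do rewrite EFinM.
  rewrite ge0_integralZl_EFin//; last first.
  - apply/measurable_EFinP.
    rewrite (_ : (fun _ => _) = \1_(`[0, h w[%classic : set R)).
      exact: measurable_indic.
    by apply/funext => z; rewrite !indicE; congr (_%:R);
      apply/idP/idP; rewrite !inE/A/= in_itv.
  rewrite (_ : (fun _ => _) = (fun z => (\1_(`[0, h w[%classic : set R) z)%:E)).
    rewrite integral_indic// setIT.
    have /= -> /= := lebesgue_measure_itv (`[0, h w[ : interval R); rewrite lte_fin.
    case: ltP (h0 w) => [h1 _|h1 h2]; first by rewrite -EFinD subr0 EFinM.
    by rewrite (_ : h w = 0) ?mulr0 ?mule0//; apply: le_anti; rewrite h1 h2.
  by apply/funext => z; rewrite !indicE; congr (_%:R%:E);
    apply/idP/idP; rewrite !inE/A/= in_itv.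
rewrite (fubini_tonelli F)// [RHS]integral_mkcond.
apply: eq_integral => z _; rewrite patchE.
case: ifPn; rewrite ?inE ?notin_setE/= in_itv/= andbT => z0.
  rewrite [RHS]integral_mkcond; apply: eq_integral => w _.
  rewrite /F/= patchE indicE; case: ifPn; rewrite ?inE ?notin_setE/= => zh.
    by rewrite mem_set ?mulr1// /A/= z0.
  by rewrite memNset ?mulr0// /A/= => /andP[].
apply: integral0_eq => w _; rewrite /F/= indicE memNset ?mulr0// /A/= => /andP[//].
Qed.

(** The layer-cake formula turns both sides into integrals over the levels z, whose integrands agree
    by hypothesis. *)
Lemma weighted_expectation d0 (Omega : measurableType d0) (R : realType)
    (P : probability Omega R) (g h : Omega -> R) (K : R) :
    measurable_fun setT g -> (forall w, 0 <= g w) ->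
    measurable_fun setT h -> (forall w, 0 <= h w) -> 0 <= K ->
    (forall z : R, \int[P]_(w in [set w | (z < h w)%R]) (g w)%:E =
      K%:E * P [set w | (z < h w)%R])%E ->
  (\int[P]_w (g w * h w)%:E = K%:E * \int[P]_w (h w)%:E)%E.
Proof.
move=> mg g0 mh h0 K0 H.
have mlt z : measurable [set w | z < h w] by exact: measurable_lt_fun.
have int1 z : (\int[P]_(w in [set w | (z < h w)%R]) (cst 1 w : R)%:E =
    P [set w | (z < h w)%R])%E.
  by rewrite (eq_integral (cst 1%E))// integral_cst// mul1e.
have := @integral_layer_cake _ _ _ P (cst 1) h (measurable_cst _) (fun=> ler01) mh h0.
under eq_integral do rewrite mul1r.
move=> ->; rewrite -ge0_integralZl//; last first.
- by move=> z _; apply: integral_ge0 => w _; rewrite lee_fin.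
(* Measurability in z of P{h > z} is that of the complementary distribution function of [h]. *)
- pose mh_mixin := isMeasurableFun.Build _ _ _ _ _ mh.
  pose mh_pack : {RV P >-> R} := HB.pack h mh_mixin.
  apply: (@eq_measurable_fun _ _ _ _ _ (ccdf mh_pack)).
    move=> z _; rewrite int1 /ccdf/= /distribution/= /pushforward/=.
    by congr (P _); apply/seteqP; split => w /=; rewrite in_itv/= andbT.
  by apply: measurable_funTS; exact: ccdf_measurable.
rewrite integral_layer_cake//; apply: eq_integral => z _.
by rewrite H int1.
Qed.

(** This is the exchange used once per index in [integral_prod_indep]: if the weight [g] factors out
    against all lower rays of [X], it factors out against any nonnegative measurable function of
    [X]. *)
Lemma expectation_prod_swap d0 (Omega : measurableType d0) (R : realType)
    (P : probability Omega R) (g X : Omega -> R) (f : R -> R) (K : R) :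
    measurable_fun setT g -> (forall w, 0 <= g w) ->
    (\int[P]_w (g w)%:E < +oo)%E ->
    measurable_fun setT X ->
    measurable_fun setT f -> (forall x, 0 <= f x) -> 0 <= K ->
    (forall y : R, \int[P]_(w in [set w | (X w <= y)%R]) (g w)%:E =
      K%:E * P [set w | (X w <= y)%R])%E ->
  (\int[P]_w (g w * f (X w))%:E = K%:E * \int[P]_w (f (X w))%:E)%E.
Proof.
move=> mg g0 gfin mX mf f0 K0 H.
apply: (@weighted_expectation _ _ _ P g (f \o X)) => //.
- exact: measurableT_comp.
- by move=> w /=.
move=> z; have := @weighted_distribution_unique _ _ _ P g X mg g0 mX K K0 gfin H
  [set x | z < f x].
by apply; exact: measurable_lt_fun.
Qed.

(** The product on the right is taken in [R]; the factors it is used for are bounded, so [fine]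
    loses nothing. *)
Definition factorizes d0 (Omega : measurableType d0) (R : realType)
    (P : probability Omega R) (n : nat) (X : 'I_n -> Omega -> R)
    (f : 'I_n -> R -> R) : Prop :=
  (\int[P]_w (\prod_i f i (X i w))%:E =
   (\prod_i fine (\int[P]_w (f i (X i w))%:E))%:E)%E.

Lemma integral_prod_indep d0 (Omega : measurableType d0) (R : realType)
    (P : probability Omega R) (n : nat) (X : 'I_n -> Omega -> R)
    (f : 'I_n -> R -> R) (M : R) :
    (forall i, measurable_fun setT (X i)) ->
    (forall y : 'I_n -> R, P [set w | forall i, X i w <= y i] =
      (\prod_i fine (P [set w | X i w <= y i]))%:E) ->
    (forall i, measurable_fun setT (f i)) ->
    (forall i x, 0 <= f i x <= M) ->
  factorizes P X f.
Proof.
move=> mX indep mf fM.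
have M0 : (0 < n)%N -> 0 <= M.
  by move=> n0; have /andP[/le_trans] := fM (Ordinal n0) 0; exact.
(* With M at least 1, indicators of rays obey the same bound as the given factors and may be mixed
   with them. *)
wlog M1 : M fM {M0} / 1 <= M.
  move=> /(_ (Num.max 1 M)); apply; last by rewrite le_max lexx.
  by move=> i x; have /andP[-> /=] := fM i x; rewrite le_max orbC => ->.
pose adm (f : R -> R) := measurable_fun setT f /\ forall x, 0 <= f x <= M.
pose ray y : R -> R := \1_(`]-oo, y]%classic : set R).
have adm_ray y : adm (ray y).
  split; first exact: measurable_indic.
  by move=> x; rewrite /ray indicE; case: (_ \in _); rewrite ?ler01 ?lexx ?(le_trans ler01)//=.
(* The factors whose index lies outside s are still indicators of lower rays;
   adding an index to s swaps one indicator for a general factor. *)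
suff : forall (s : seq 'I_n) f, (forall i, adm (f i)) ->
    (forall i, i \notin s -> exists y, f i = ray y) -> factorizes P X f.
  move=> /(_ (enum 'I_n) f); apply; first by move=> i; split.
  by move=> i; rewrite mem_enum.
have le_set i y : [set w | X i w <= y] = X i @^-1` `]-oo, y].
  by apply/seteqP; split => w /=; rewrite in_itv.
have mle i y : measurable [set w | X i w <= y] by exact: measurable_le_fun.
have rayE i y w : ray y (X i w) = \1_[set w | X i w <= y] w.
  by rewrite /ray !indicE le_set !mem_setE/= in_itv.
have int_ray i y : (\int[P]_w (ray y (X i w))%:E = P [set w | (X i w <= y)%R])%E.
  by under eq_integral do rewrite rayE; rewrite integral_indic// setIT.
have madm f' i : adm f' -> measurable_fun setT (fun w => f' (X i w)).
  by move=> [mf' _]; exact: measurableT_comp.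
have mprod f' (A : pred 'I_n) : (forall i, adm (f' i)) ->
    measurable_fun setT (fun w => \prod_(i | A i) f' i (X i w)).
  move=> af; under eq_fun do rewrite big_mkcond/=.
  apply: measurable_prod => i _; case: (A i) => //; exact: madm.
have prod_ge0 f' (A : pred 'I_n) w : (forall i, adm (f' i)) ->
    0 <= \prod_(i | A i) f' i (X i w).
  by move=> af; apply: prodr_ge0 => i _; have /andP[] := (af i).2 (X i w).
elim=> [|k s IH] {mf fM} {}f admf fs.
  (* No general factor is left: the product is the indicator of a joint lower orthant, and [indep]
     applies. *)
  have /choice[y fy] : forall i, exists y, f i = ray y by move=> i; exact: fs.
  rewrite /factorizes.
  transitivity (P [set w | forall i, X i w <= y i]).
    have mC : measurable [set w | forall i, X i w <= y i].
      rewrite (_ : [set w | _] = \bigcap_(i in [set: 'I_n]) [set w | X i w <= y i]).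
        by apply: fin_bigcap_measurable.
      by apply/seteqP; split => w /= H i; [move=> _; exact: H|exact: H].
    transitivity (\int[P]_w (\1_[set w | forall i, X i w <= y i] w)%:E)%E;
      last by rewrite integral_indic// setIT.
    apply: eq_integral => w _; congr (_%:E).
    under eq_bigr do rewrite fy rayE.
    rewrite [in RHS]indicE; case: (boolP (_ \in _)).
      by rewrite inE/= => H; rewrite big1// => i _; rewrite indicE mem_set/=.
    rewrite notin_setE/= => /existsNP[i Hi].
    by rewrite (bigD1 i)//= indicE memNset// mul0r.
  by rewrite indep; under [in RHS]eq_bigr do rewrite fy int_ray.
pose g w := \prod_(i | i != k) f i (X i w).
pose K := \prod_(i | i != k) fine (\int[P]_w (f i (X i w))%:E)%E.
have K0 : 0 <= K.
  apply: prodr_ge0 => i _; apply/fine_ge0/integral_ge0 => w _; rewrite lee_fin.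
  by have /andP[] := (admf i).2 (X i w).
rewrite /factorizes; under eq_integral do rewrite (bigD1 k)//= mulrC.
rewrite (@expectation_prod_swap _ _ _ P g (X k) (f k) K)//.
- rewrite (bigD1 k)//= mulrC EFinM fineK//.
  apply: (@bounded_integral_fin_num _ _ _ _ _ M); first exact: madm.
  by move=> w; exact: (admf k).2.
- exact: mprod.
- by move=> w; exact: prod_ge0.
- suff : (\int[P]_w (g w)%:E)%E \is a fin_num.
    by rewrite ge0_fin_numE// integral_ge0// => w _; rewrite lee_fin prod_ge0.
  apply: (@bounded_integral_fin_num _ _ _ _ _ (\prod_(i | i != k) M)); first exact: mprod.
  move=> w; rewrite prod_ge0//=; apply: ler_prod => i _.
  exact: (admf i).2.
- by case: (admf k).
- by move=> x; have /andP[] := (admf k).2 x.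
(* The hypothesis on rays for the weight [g] is the induction hypothesis with the factor of index
   [k] replaced by the indicator of a ray. *)
move=> y; pose f' i := if i == k then ray y else f i.
have af' i : adm (f' i) by rewrite /f'; case: ifP.
have : factorizes P X f'.
  apply: IH => // i si; rewrite /f'; case: eqP => [_|/eqP ik]; first by exists y.
  by apply: fs; rewrite inE negb_or ik.
rewrite /factorizes (bigD1 k)//= {2}/f' eqxx int_ray.
rewrite (_ : \prod_(i | i != k) _ = K); last first.
  by apply: eq_bigr => i /negPf ik; rewrite /f' ik.
rewrite mulrC EFinM fineK ?fin_num_measure// => <-.
rewrite integral_mkcond; apply: eq_integral => w _.
rewrite patchE (bigD1 k)//= {1}/f' eqxx rayE indicE.
rewrite (_ : \prod_(i | i != k) _ = g w); last first.
  by apply: eq_bigr => i /negPf ik; rewrite /f' ik.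
by case: ifPn => _; rewrite ?mul1r ?mul0r.
Qed.

(** * Tails of maxima and their limiting moment *)

(** For u < 1, exp(- u / (1 - u)) <= 1 - u <= exp(- u). Raised to the power n, both bounds tend to
    exp(- a), since [u n] tends to 0. This is the Poisson limit behind the law of the maximum. *)
Lemma cvg_onem_exp (R : realType) (u : R^nat) (a : R) :
    (forall n, 0 <= u n <= 1) -> n%:R * u n @[n --> \oo] --> a ->
  (1 - u n) ^+ n @[n --> \oo] --> expR (- a).
Proof.
move=> u01 nua.
have u0 : u n @[n --> \oo] --> (0 : R).
  have : n%:R^-1 * (n%:R * u n) @[n --> \oo] --> 0 * a.
    apply: cvgM => //; apply/gtr0_cvgV0; last exact: cvgr_idn.
    by near=> n; rewrite ltr0n; near: n; exact: nbhs_infty_gt.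
  rewrite mul0r; apply: cvg_trans; apply: near_eq_cvg; near=> n.
  rewrite mulrA mulVf ?mul1r// pnatr_eq0 -lt0n; near: n; exact: nbhs_infty_gt.
have low : expR (- (n%:R * u n / (1 - u n))) @[n --> \oo] --> expR (- a).
  apply: continuous_cvg; first exact: continuous_expR.
  apply: cvgN; rewrite -[X in _ --> X]mulr1 -[X in _ * X]invr1.
  apply: cvgM => //; apply: cvgV; first exact: oner_neq0.
  by rewrite -[X in _ --> X](subr0 1); apply: cvgB => //; exact: cvg_cst.
have upp : expR (- (n%:R * u n)) @[n --> \oo] --> expR (- a).
  by apply: continuous_cvg; [exact: continuous_expR|exact: cvgN].
apply: squeeze_cvgr low upp; near=> n.
have /andP[un0 _] := u01 n.
have un1 : u n < 1.
  by near: n; apply: cvgr_lt u0 _ _; exact: ltr01.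
have -> : - (n%:R * u n / (1 - u n)) = n%:R * - (u n / (1 - u n)) by rewrite mulrN mulrA.
rewrite -(mulrN n%:R (u n)) !expRM_natl; apply/andP; split; apply: lerXn2r;
  rewrite ?nnegrE ?expR_ge0 ?subr_ge0 ?(ltW un1)//; last exact: expR_ge1Dx.
rewrite expRN -[leRHS]invrK lef_pV2 ?posrE ?invr_gt0 ?subr_gt0 ?expR_gt0//.
apply: le_trans (expR_ge1Dx _).
have : 1 - u n != 0 by rewrite gt_eqF// subr_gt0.
by move=> un; rewrite le_eqVlt; apply/orP; left; apply/eqP; field.
Unshelve. all: by end_near. Qed.

(** Convergence bounds [T] only at the points n^(1/alpha). Monotonicity carries the bound to every
    x, with n the integer part of x^alpha. *)
Lemma regular_tail_bound (R : realType) (T : R -> R) (alpha c : R) :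
    0 < alpha -> (forall x, 0 <= T x <= 1) ->
    {homo T : x y / x <= y >-> y <= x} ->
    n%:R * T (n%:R `^ alpha^-1) @[n --> \oo] --> c ->
  exists2 C : R, 0 < C & forall x, 0 < x -> T x <= C * x `^ (- alpha).
Proof.
move=> a0 T01 Tdec cT.
have : cvgn (fun n => n%:R * T (n%:R `^ alpha^-1)) by apply/cvg_ex; exists c.
move=> /cvg_seq_bounded/pinfty_ex_gt0[M M_gt0 /= uM].
exists (Num.max 1 (2 * M)); first by rewrite lt_max ltr01.
move=> x x0; have xa0 : 0 < x `^ alpha by exact: powR_gt0.
rewrite powRN ler_pdivlMr//.
have /andP[T0 T1] := T01 x.
have [x1|x1] := ltP (x `^ alpha) 1.
  by rewrite le_max mulr_ile1// ltW.
rewrite le_max; apply/orP; right.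
set n := Num.truncn (x `^ alpha).
have n1 : (0 < n)%N by rewrite truncn_gt0.
have nx : n%:R <= x `^ alpha by rewrite truncn_le// ltW.
have xn : x `^ alpha <= 2 * n%:R.
  apply: ltW; apply: lt_le_trans (truncnS_gt _) _.
  by rewrite -natrM ler_nat -/n mul2n -addnn -addn1 leq_add2l.
have := uM n I; rewrite ger0_norm ?mulr_ge0//; last by have /andP[] := T01 (n%:R `^ alpha^-1).
move=> unM; apply: le_trans (_ : T x * (2 * n%:R) <= _); first by rewrite ler_wpM2l.
rewrite mulrCA ler_pM2l// mulrC; apply: le_trans unM.
rewrite ler_wpM2l// Tdec//.
have xE : x = (x `^ alpha) `^ alpha^-1.
  by rewrite -powRrM mulfV ?gt_eqF// powRr1// ltW.
rewrite [leRHS]xE; apply: ge0_ler_powR; rewrite ?nnegrE ?powR_ge0 ?ler0n//.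
by rewrite invr_ge0 ltW.
Qed.

(** Bernoulli's inequality, playing the role of a union bound: once over the vectors of a group,
    once over the groups. *)
Lemma onem_exp_onem_le (R : realType) (u : R) (n : nat) :
  0 <= u <= 1 -> 1 - (1 - u) ^+ n <= n%:R * u.
Proof.
move=> /andP[u0 u1]; elim: n => [|n IH]; first by rewrite expr0 subrr mul0r.
have : 0 <= (1 - u) ^+ n <= 1.
  by rewrite exprn_ge0 ?subr_ge0// exprn_ile1 ?subr_ge0// gerBl.
by rewrite exprS -natr1; nra.
Qed.

Lemma ln_cvgy (R : realType) : ln x @[x --> +oo] --> (+oo : set_system R).
Proof.
apply/cvgryPge => M; near=> x.
rewrite -ler_expR lnK; last by rewrite posrE.
by near: x; apply: nbhs_pinfty_ge; rewrite num_real.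
Unshelve. all: by end_near. Qed.

Lemma powR_cvgy0 (R : realType) (a : R) : 0 < a -> x `^ (- a) @[x --> +oo] --> 0.
Proof.
move=> a0; have : expR (- (a * ln x)) @[x --> +oo] --> 0.
  apply: (@cvg_comp _ _ _ (fun x : R => a * ln x) (fun y => expR (- y)) _ (pinfty_nbhs R)).
    by apply: gt0_cvgMry => //; exact: ln_cvgy.
  exact: cvgr_expR.
apply: cvg_trans; apply: near_eq_cvg; near=> x.
by rewrite /powR gt_eqF// mulNr.
Unshelve. all: by end_near. Qed.

Lemma integral_powR_lty (R : realType) (p : R) : 1 < p ->
  (\int[lebesgue_measure]_(z in `[1%R, +oo[) (z `^ (- p))%:E < +oo)%E.
Proof.
move=> p1; have p0 : 0 < p - 1 by rewrite subr_gt0.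
pose F (z : R) : R := - (p - 1)^-1 * z `^ (1 - p).
have dF (x : R) : 0 < x -> is_derive x 1 F (x `^ (- p)).
  move=> x0; have h : is_derive x 1 (@powR R ^~ (1 - p)) ((1 - p) * x `^ (1 - p - 1)).
    exact: is_derive1_powR.
  apply: (is_derive_eq (is_deriveZ (- (p - 1)^-1) h)).
  rewrite /GRing.scale/= mulrA (_ : - (p - 1)^-1 * (1 - p) = 1); last first.
    by field; rewrite subr_eq0 gt_eqF.
  by rewrite mul1r; congr (_ `^ _); ring.
have cF (x : R) : 0 < x -> {for x, continuous F}.
  move=> x0; apply: differentiable_continuous; apply/derivable1_diffP.
  by case: (dF x x0).
rewrite (@ge0_continuous_FTC2y _ _ F 1 0).
- by rewrite -EFinB ltry.
- by move=> x _; exact: powR_ge0.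
- apply: continuous_in_subspaceT => x; rewrite inE/= in_itv/= andbT => x1.
  apply: differentiable_continuous; apply/derivable1_diffP.
  by apply: derivable_powR; rewrite in_itv/= andbT (lt_le_trans ltr01).
- rewrite -[X in _ --> X](mulr0 (- (p - 1)^-1)).
  by apply: cvgMr; rewrite -opprB; exact: powR_cvgy0.
- by move=> x x1; case: (dF x (lt_trans ltr01 x1)).
- by apply: cvg_at_right_filter; exact: cF.
- move=> x; rewrite in_itv/= andbT => x1; rewrite derive1E.
  by have [] := dF x (lt_trans ltr01 x1).
Qed.

(** The cap at 1 removes the singularity of z^(-p) at 0, and p > 1 gives integrability at infinity.
    It dominates every tail integral below, with p = alpha / t. *)
Lemma integrable_tail_dominator (R : realType) (C p : R) : 0 <= C -> 1 < p ->
  lebesgue_measure.-integrable `]0%R, +oo[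
    (fun z : R => (Num.min 1 (C * z `^ (- p)))%:E).
Proof.
move=> C0 p1.
have m0 z : 0 <= Num.min 1 (C * z `^ (- p)) by rewrite le_min ler01 mulr_ge0 ?powR_ge0.
have mf : measurable_fun setT (fun z : R => Num.min 1 (C * z `^ (- p))).
  apply: (@measurable_minr _ _ _ _ (cst 1)) => //; apply: measurable_funM => //.
apply/integrableP; split; first by apply/measurable_EFinP/measurable_funTS.
under eq_integral do rewrite /= ger0_norm//.
rewrite (_ : `]0, +oo[%classic = `]0, 1] `|` `]1, +oo[); last first.
  by rewrite -itv_bndbnd_setU ?bnd_simp// ltW.
rewrite ge0_integral_setU//=; last 3 first.
- by apply/measurable_EFinP/measurable_funTS.
- by move=> x _; rewrite lee_fin.
- rewrite disj_set2E; apply/eqP/seteqP; split => x //=; rewrite !in_itv/= andbT.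
  by move=> -[/andP[_ /le_lt_trans h] /h]; rewrite ltxx.
apply: lte_add_pinfty.
  apply: le_lt_trans
    (_ : \int[lebesgue_measure]_(x in `]0%R, 1%R]) cst 1 x < _)%E.
    apply: ge0_le_integral => //=.
    - by move=> x _; rewrite lee_fin.
    - by apply/measurable_EFinP/measurable_funTS.
    - by move=> x _; rewrite lee_fin ge_min lexx.
  rewrite integral_cst//= mul1e.
  have := lebesgue_measure_itv (`]0%R, 1] : interval R).
  by move=> /= -> /=; rewrite lte_fin ltr01 -EFinB ltry.
apply: le_lt_trans (_ :
    \int[lebesgue_measure]_(x in `[1%R, +oo[) (C%:E * (x `^ (- p))%:E) < _)%E.
  rewrite integral_itv_obnd_cbnd; last by apply/measurable_EFinP/measurable_funTS.
  apply: ge0_le_integral => //=.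
  - by move=> x _; rewrite lee_fin.
  - by apply/measurable_EFinP/measurable_funTS.
  - by apply/measurable_EFinP/measurable_funTS; apply: measurable_funM.
  - by move=> x _; rewrite lee_fin ge_min lexx orbT.
rewrite ge0_integralZl_EFin//.
- apply: lte_mul_pinfty => //; first exact: integral_powR_lty.
- by move=> x _; rewrite lee_fin powR_ge0.
- by apply/measurable_EFinP/measurable_funTS; exact: measurable_powR.
Qed.

Lemma expR_integral_itv (R : realType) (a : R) : 0 < a ->
  (\int[lebesgue_measure]_(x in `]0%R, a]) (expR (- x))%:E = (1 - expR (- a))%:E)%E.
Proof.
move=> a0; have := exponential_prob_itv0c 1 a0.
rewrite mulN1r EFinB => <-.
rewrite /exponential_prob -integral_itv_obnd_cbnd; last first.
  apply/measurable_EFinP; apply: measurable_funTS.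
  exact: measurable_exponential_pdf.
apply: eq_integral => x; rewrite inE/= in_itv/= => /andP[x0 _].
by rewrite exponential_pdfE ?(ltW x0)// mul1r mulN1r.
Qed.

(* Both sides are the double integral of exp(- x) over the region
   x <= c z^(-1/s), that is z <= c^s x^(-s). *)
Lemma frechet_moment_Gamma (R : realType) (s c : R) : 0 < s -> 0 < c ->
  (\int[lebesgue_measure]_(z in `]0%R, +oo[) (1 - expR (- (c * z `^ (- s^-1))))%:E
   = (c `^ s)%:E *
     \int[lebesgue_measure]_(x in `]0%R, +oo[) (x `^ (- s) * expR (- x))%:E)%E.
Proof.
move=> s0 c0.
pose A := [set p : measurableTypeR R * measurableTypeR R |
  [&& 0 < p.1, 0 < p.2 & p.1 <= c * p.2 `^ (- s^-1)]].
pose F (p : measurableTypeR R * measurableTypeR R) : \bar R :=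
  (expR (- p.1) * \1_A p)%:E.
have mA : measurable A.
  apply: measurable_set_bool; apply: measurable_and.
    by apply: measurable_fun_ltr.
  apply: measurable_and; first by apply: measurable_fun_ltr.
  apply: measurable_fun_ler => //; apply: measurable_funM => //.
  apply: (measurableT_comp (measurable_powR _)).
  exact: measurable_snd.
have mF : measurable_fun setT F.
  apply/measurable_EFinP/measurable_funM.
    by do 2 apply: measurableT_comp => //.
  exact: measurable_indic.
have F0 p : (0 <= F p)%E by rewrite lee_fin mulr_ge0// expR_ge0.
have AE x z : 0 < x -> 0 < z ->
    (x <= c * z `^ (- s^-1)) = (z <= c `^ s * x `^ (- s)).
  move=> x0 z0.
  rewrite !powRN !ler_pdivlMr ?powR_gt0//.
  rewrite -(gt0_powR_le s0) ?mulr_ge0 ?powR_ge0 ?(ltW x0) ?(ltW c0)//.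
  rewrite powRM ?powR_ge0 ?(ltW x0)// -powRrM mulVf ?gt_eqF// powRr1 ?(ltW z0)//.
  by rewrite mulrC.
transitivity (\int[lebesgue_measure]_z \int[lebesgue_measure]_x F (x, z))%E.
  rewrite integral_mkcond; apply: eq_integral => z _; rewrite patchE.
  case: ifPn; rewrite ?inE ?notin_setE/= in_itv/= andbT => z0.
    rewrite -expR_integral_itv ?mulr_gt0 ?powR_gt0// integral_mkcond.
    apply: eq_integral => x _; rewrite patchE /F/= indicE.
    case: ifPn; rewrite ?inE ?notin_setE/= in_itv/= => xz.
      by rewrite mem_set ?mulr1// /A/= z0.
    by rewrite memNset ?mulr0// /A/= z0.
  by apply/esym/integral0_eq => x _; rewrite /F/= indicE memNset ?mulr0// /A/= => /and3P[].
rewrite -(fubini_tonelli F)//.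
rewrite -ge0_integralZl//; last 3 first.
- apply/measurable_EFinP/measurable_funTS; apply: measurable_funM => //.
  by apply: measurableT_comp => //.
- by move=> x _; rewrite lee_fin mulr_ge0 ?powR_ge0 ?expR_ge0.
- by rewrite lee_fin powR_ge0.
rewrite [RHS]integral_mkcond; apply: eq_integral => x _; rewrite patchE.
case: ifPn; rewrite ?inE ?notin_setE/= in_itv/= andbT => x0; last first.
  by apply: integral0_eq => z _; rewrite /F/= indicE memNset ?mulr0// /A/= => /and3P[].
transitivity (\int[lebesgue_measure]_(z in `]0%R, (c `^ s * x `^ (- s))%R]) (expR (- x))%:E)%E.
  rewrite [RHS]integral_mkcond; apply: eq_integral => z _.
  rewrite patchE /F/= indicE.
  case: ifPn; rewrite ?inE ?notin_setE/= in_itv/= => xz.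
    have /andP[z0 zx] := xz.
    by rewrite mem_set ?mulr1// /A/= z0 x0 AE.
  rewrite memNset ?mulr0// /A/= => /and3P[_ z0]; rewrite AE// => zx.
  by apply: xz; rewrite z0 zx.
rewrite integral_cst//=.
have := lebesgue_measure_itv (`]0%R, c `^ s * x `^ (- s)]  : interval R).
move=> /= -> /=; rewrite lte_fin mulr_gt0 ?powR_gt0//=.
by rewrite -EFinB -!EFinM subr0; congr (_%:E); ring.
Qed.

Lemma onem_expRN_le (R : realType) (x : R) : 0 <= x -> 0 <= 1 - expR (- x) <= Num.min 1 x.
Proof.
move=> x0; rewrite subr_ge0 -[X in _ <= X]expR0 ler_expR oppr_le0 x0/= le_min gerBl expR_ge0/=.
by have := expR_ge1Dx (- x); lra.
Qed.

Lemma measurable_frechet (R : realType) (c q : R) :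
  measurable_fun setT (fun z : R => 1 - expR (- (c * z `^ q))).
Proof.
apply: measurable_funB => //; apply: measurableT_comp => //.
by apply: measurable_funN; exact: measurable_funM.
Qed.

(** The left side is the t-th moment of the limiting Fréchet law, with s = t / alpha. Finiteness of
    the Gamma integral, needed to undo [fine], comes from the identity at c = 1 and the integrable
    dominator of exponent 1/s > 1. At c = 0 both sides vanish. *)
Lemma frechet_moment (R : realType) (s c : R) : 0 < s < 1 -> 0 <= c ->
  (\int[lebesgue_measure]_(z in `]0%R, +oo[) (1 - expR (- (c * z `^ (- s^-1))))%:E
   = (c `^ s * Gamma (1 - s))%:E)%E.
Proof.
move=> /andP[s0 s1] c0.
have GE : Gamma (1 - s) =
    fine (\int[lebesgue_measure]_(x in `]0%R, +oo[) (x `^ (- s) * expR (- x))%:E)%E.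
  rewrite /Gamma /Rintegral; congr fine; apply: eq_integral => x _.
  by congr (_ `^ _ * _)%:E; ring.
have Gfin : (\int[lebesgue_measure]_(x in `]0%R, +oo[) (x `^ (- s) * expR (- x))%:E)%E
    \is a fin_num.
  rewrite ge0_fin_numE; last first.
    by apply: integral_ge0 => x _; rewrite lee_fin mulr_ge0 ?powR_ge0 ?expR_ge0.
  have := frechet_moment_Gamma s0 (@ltr01 R); rewrite powR1 mul1e => <-.
  have p1 : 1 < s^-1 by rewrite -[X in X < _]invr1 ltf_pV2 ?posrE.
  have := integrable_tail_dominator ler01 p1 => /integrableP[mg].
  apply: le_lt_trans; apply: ge0_le_integral => //=.
  - move=> z _; rewrite lee_fin mul1r.
    by have /andP[] := onem_expRN_le (powR_ge0 z (- s^-1)).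
  - by apply/measurable_EFinP/measurable_funTS; exact: measurable_frechet.
  - by apply/measurable_EFinP; apply: measurableT_comp => //; exact/measurable_EFinP.
  - move=> z _; rewrite lee_fin; apply: le_trans (ler_norm _).
    by rewrite !mul1r; have /andP[] := onem_expRN_le (powR_ge0 z (- s^-1)).
move: c0; rewrite le_eqVlt => /predU1P[<-|c0].
  rewrite powR0 ?gt_eqF// mul0r; apply: integral0_eq => z _.
  by rewrite mul0r oppr0 expR0 subrr.
by rewrite frechet_moment_Gamma// GE EFinM fineK.
Qed.

(** At c = 1 the Fréchet moment equals Gamma(1 - s), and its integrand is at least 1 - exp(-1) on
    ]0, 1]. *)
Lemma Gamma_gt0 (R : realType) (s : R) : 0 < s < 1 -> 0 < Gamma (1 - s).
Proof.
move=> s01; have /andP[s0 _] := s01.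
have := frechet_moment s01 ler01; rewrite powR1 mul1r => GE.
rewrite -lte_fin -GE.
pose k : R := 1 - expR (- 1).
have k0 : 0 < k by rewrite subr_gt0 -[ltRHS]expR0 ltr_expR oppr_lt0.
have pos (z : R) : (0 <= (1 - expR (- (1 * z `^ (- s^-1))))%:E)%E.
  by rewrite lee_fin mul1r; have /andP[] := onem_expRN_le (powR_ge0 z (- s^-1)).
have mf : measurable_fun setT (fun z : R => (1 - expR (- (1 * z `^ (- s^-1))))%:E).
  by apply/measurable_EFinP; exact: measurable_frechet.
apply: lt_le_trans (_ : \int[lebesgue_measure]_(z in `]0%R, 1%R]) (cst k%:E z) <= _)%E.
  rewrite integral_cst//=.
  have := lebesgue_measure_itv (`]0%R, 1] : interval R).
  by move=> /= -> /=; rewrite lte_fin ltr01 -EFinB -EFinM lte_fin subr0 mulr1.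
apply: le_trans (_ : \int[lebesgue_measure]_(z in `]0%R, 1%R])
    (1 - expR (- (1 * z `^ (- s^-1))))%:E <= _)%E; last first.
  apply: ge0_subset_integral => //=.
  - exact: measurable_funTS.
  - by move=> z /=; rewrite !in_itv/= => /andP[-> _].
apply: ge0_le_integral => //=.
- by move=> z _; rewrite lee_fin ltW.
- exact: measurable_funTS.
- move=> z; rewrite in_itv/= => /andP[z0 z1]; rewrite lee_fin lerD2l lerN2 ler_expR lerN2.
  rewrite mul1r powRN invf_ge1 ?powR_gt0//.
  rewrite [leRHS](_ : 1 = 1 `^ s^-1); last by rewrite powR1.
  by apply: ge0_ler_powR => //; rewrite ?nnegrE ?invr_ge0 ltW.
Qed.

(* P{min(q^t, L) > z} for the normalized maximum q of m vectors with tail T. *)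
Definition truncated_tail (R : realType) (T : R -> R) (alpha t : R) (m : nat)
    (L z : R) : R :=
  if z < L then 1 - (1 - T (z `^ t^-1 * m%:R `^ alpha^-1)) ^+ m else 0.

Lemma measurable_truncated_tail (R : realType) (T : R -> R) (alpha t L : R) (m : nat) :
  measurable_fun setT T -> measurable_fun setT (truncated_tail T alpha t m L).
Proof.
move=> mT; apply: measurable_fun_ifT => //.
  by apply: measurable_fun_ltr.
apply: measurable_funB => //; apply: measurable_funX; apply: measurable_funB => //.
by apply: measurableT_comp => //; apply: measurable_funM.
Qed.

(** The bound is uniform in m: the union bound costs a factor m, and the normalization m^(1/alpha)
    inside the tail gains exactly 1/m. *)
Lemma max_tail_le (R : realType) (T : R -> R) (alpha t C z : R) (m : nat) :
    0 < alpha -> 0 < t -> 0 < z -> (forall x, 0 <= T x <= 1) ->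
    (forall x, 0 < x -> T x <= C * x `^ (- alpha)) ->
  1 - (1 - T (z `^ t^-1 * m%:R `^ alpha^-1)) ^+ m <= C * z `^ (- (alpha / t)).
Proof.
move=> a0 t0 z0 T01 TC.
apply: (le_trans (onem_exp_onem_le m (T01 _))).
(* At m = 0 the argument of [T] is 0, where [TC] says nothing; the bound reduces to C >= 0, read off
   at x = 1. *)
case: m => [|m].
  rewrite mul0r; apply: mulr_ge0; last exact: powR_ge0.
  have := TC 1 ltr01; rewrite powR1 mulr1; apply: le_trans.
  by have /andP[] := T01 1.
apply: (le_trans (ler_wpM2l _ (TC _ _))); rewrite ?mulr_gt0 ?powR_gt0//.
rewrite powRM ?powR_ge0// -!powRrM !mulrN mulVf ?gt_eqF// powR_inv1// [t^-1 * _]mulrC.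
have : m.+1%:R != 0 :> R by rewrite pnatr_eq0.
move: (m.+1%:R) (z `^ _) => M w M0.
by rewrite le_eqVlt; apply/orP; left; apply/eqP; field.
Qed.

(** Dominated convergence: for fixed z the truncation is eventually inactive, and the tail condition
    at rho = z^(1/t) gives the pointwise limit. The dominator is integrable because t < alpha makes
    alpha / t > 1. *)
Lemma truncated_tail_cvg (R : realType) (T : R -> R) (alpha c t C : R)
    (m : nat -> nat) (L : R^nat) :
    0 < alpha -> 0 < t -> t < alpha -> 0 <= c -> 0 <= C ->
    measurable_fun setT T -> (forall x, 0 <= T x <= 1) ->
    (forall x, 0 < x -> T x <= C * x `^ (- alpha)) ->
    (forall rho, 0 < rho ->
      n%:R * T (rho * n%:R `^ alpha^-1) @[n --> \oo] --> c * rho `^ (- alpha)) ->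
    m @ \oo --> \oo -> L @ \oo --> +oo ->
  (\int[lebesgue_measure]_(z in `]0%R, +oo[)
    (truncated_tail T alpha t (m N) (L N) z)%:E)%E @[N --> \oo] -->
  (c `^ (t / alpha) * Gamma (1 - t / alpha))%:E.
Proof.
move=> a0 t0 ta c0 C0 mT T01 TC Tc moo Loo.
have s01 : 0 < t / alpha < 1 by rewrite divr_gt0//= ltr_pdivrMr// mul1r.
rewrite -frechet_moment// invf_div.
have pow01 z k := onem_expn_itv01 k (T01 (z `^ t^-1 * k%:R `^ alpha^-1)).
have tt0 k l z : 0 <= truncated_tail T alpha t k l z.
  by rewrite /truncated_tail; case: ifP => // _; have /andP[] := pow01 z k.
have mtt k l : measurable_fun setT (truncated_tail T alpha t k l).
  exact: measurable_truncated_tail.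
have DC := (@dominated_convergence _ _ R lebesgue_measure `]0%R, +oo[%classic
  (measurable_itv _) (fun N z => (truncated_tail T alpha t (m N) (L N) z)%:E)
  (fun z => (1 - expR (- (c * z `^ (- (alpha / t)))))%:E)
  (fun z : R => (Num.min 1 (C * z `^ (- (alpha / t))))%:E)).
apply: (fun a b c d e => let: And3 _ _ h := DC a b c d e in h).
- by move=> N; apply/measurable_EFinP/measurable_funTS; exact: mtt.
- by apply/measurable_EFinP/measurable_funTS; exact: measurable_frechet.
- apply: aeW => z /=; rewrite in_itv/= andbT => z0.
  apply: cvg_EFin; first exact: nearW.
  have zt0 : 0 < z `^ t^-1 by exact: powR_gt0.
  have := Tc _ zt0; rewrite -powRrM mulrN [t^-1 * _]mulrC => Tcz.
  have h : 1 - (1 - T (z `^ t^-1 * n%:R `^ alpha^-1)) ^+ n @[n --> \oo] -->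
      1 - expR (- (c * z `^ (- (alpha / t)))).
    apply: cvgB; first exact: cvg_cst.
    by apply: cvg_onem_exp Tcz => n; exact: T01.
  have := cvg_comp _ _ moo h.
  apply: cvg_trans; apply: near_eq_cvg; near=> N.
  rewrite /= /truncated_tail ifT//; near: N.
  by move/cvgryPgt : Loo; apply.
- apply: integrable_tail_dominator => //.
  by rewrite ltr_pdivlMr// mul1r.
- apply: aeW => z N /=; rewrite in_itv/= andbT => z0.
  rewrite lee_fin ger0_norm// le_min /truncated_tail; case: ifP => _.
    by have /andP[_ ->]/= := pow01 z (m N); exact: max_tail_le.
  by rewrite ler01 mulr_ge0 ?powR_ge0.
Unshelve. all: by end_near. Qed.

(** * Concentration and the Borel-Cantelli lemma *)

(** Squaring exp(u/2) <= 1 / (1 - u/2) leaves a polynomial inequality whose defect is u^2/4 times 1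
    - 3u + u^2. The latter is nonnegative for u <= 1/3, which is the origin of the constant. *)
Lemma expR_le_quadratic (R : realType) (u : R) :
  `|u| <= 3^-1 -> expR u <= 1 + u + u ^+ 2.
Proof.
rewrite ler_norml => /andP[u1 u2].
have v0 : 0 < 1 - u / 2 by lra.
have h : expR (u / 2) <= (1 - u / 2)^-1.
  rewrite -[leLHS]invrK lef_pV2 ?posrE ?invr_gt0 ?expR_gt0//.
  by rewrite -expRN; apply: le_trans (expR_ge1Dx _).
have -> : expR u = expR (u / 2) ^+ 2.
  by rewrite -expRM_natl; congr expR; field.
apply: le_trans (lerXn2r 2 _ _ h) _; rewrite ?nnegrE ?expR_ge0 ?invr_ge0 ?(ltW v0)//.
rewrite exprVn -div1r ler_pdivrMr ?exprn_gt0//.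
have -> : (1 + u + u ^+ 2) * (1 - u / 2) ^+ 2
    = 1 + (u ^+ 2 / 4) * (1 - 3 * u + u ^+ 2) by field.
rewrite lerDl mulr_ge0//; first by rewrite divr_ge0 ?sqr_ge0.
by have := sqr_ge0 u; lra.
Qed.

(* For a variable Y in [0, L], [expR_le_quadratic] and Y^2 <= L Y bound the moment
   generating function by its mean alone, so no second moment is needed. *)
Lemma chernoff_bounded_indep d0 (Omega : measurableType d0) (R : realType)
    (P : probability Omega R) (n : nat) (X : 'I_n -> Omega -> R)
    (phi : R -> R) (lambda L mu a : R) :
    (forall i, measurable_fun setT (X i)) ->
    (forall y : 'I_n -> R, P [set w | forall i, X i w <= y i] =
      (\prod_i fine (P [set w | X i w <= y i]))%:E) ->
    measurable_fun setT phi -> (forall x, 0 <= phi x <= L) ->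
    (forall i, (\int[P]_w (phi (X i w))%:E = mu%:E)%E) ->
    `|lambda| * L <= 3^-1 ->
  (P [set w | (a <= lambda * \sum_i phi (X i w))%R] <=
   (expR (n%:R * ((lambda + lambda ^+ 2 * L) * mu) - a))%:E)%E.
Proof.
move=> mX indep mphi phiL Emu lL.
have L0 : 0 <= L by have /andP[/le_trans] := phiL 0; exact.
have lphi x : `|lambda * phi x| <= 3^-1.
  apply: le_trans lL; rewrite normrM ler_wpM2l//.
  by have /andP[p0 pL] := phiL x; rewrite ger0_norm.
pose f (i : 'I_n) x := expR (lambda * phi x).
have mf i : measurable_fun setT (f i).
  by apply: measurableT_comp => //; exact: measurable_funM.
have mphiX i : measurable_fun setT (fun w => phi (X i w)) by exact: measurableT_comp.
have f_le x i : f i x <= 1 + (lambda + lambda ^+ 2 * L) * phi x.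
  apply: le_trans (expR_le_quadratic (lphi x)) _.
  rewrite -addrA lerD2l mulrDl lerD2l exprMn -(mulrA (lambda ^+ 2)) ler_wpM2l ?sqr_ge0//.
  by rewrite expr2; have /andP[p0 pL] := phiL x; rewrite ler_wpM2r.
have Ef i : fine (\int[P]_w (f i (X i w))%:E)%E <=
    expR ((lambda + lambda ^+ 2 * L) * mu).
  set k := lambda + lambda ^+ 2 * L.
  have iphi : P.-integrable setT (EFin \o (fun w => phi (X i w))).
    apply: measurable_bounded_integrable => //.
      by rewrite (le_lt_trans (probability_le1 _ _))// ltry.
    exists L; split; first by rewrite num_real.
    move=> x Lx w _ /=; have /andP[p0 pL] := phiL (X i w).
    by rewrite ger0_norm// (le_trans pL)// ltW.
  pose e1 : Omega -> R := cst 1.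
  pose e2 w := k * phi (X i w).
  have ikphi : P.-integrable setT (EFin \o e2).
    exact: (integrableZl _ k iphi).
  have i1 : P.-integrable setT (EFin \o e1).
    by apply: finite_measure_integrable_cst.
  have int1 : (\int[P]_w (1 + k * phi (X i w))%:E = (1 + k * mu)%:E)%E.
    transitivity (\int[P]_w ((EFin \o e1) w + (EFin \o e2) w))%E; first by [].
    rewrite integralD// EFinD; congr (_ + _)%E.
      have := @integral_cst _ _ _ P setT measurableT 1%E.
      by rewrite mul1e [RHS]probability_setT => <-.
    transitivity (\int[P]_w (k%:E * (EFin \o (fun w => phi (X i w))) w))%E.
      by apply: eq_integral => w _; rewrite /= /e2 EFinM.
    by rewrite integralZl//= Emu.
  have Ele : (\int[P]_w (f i (X i w))%:E <= (1 + k * mu)%:E)%E.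
    rewrite -int1; apply: ge0_le_integral => //.
    - by move=> w _; rewrite lee_fin expR_ge0.
    - by apply/measurable_EFinP; exact: measurableT_comp.
    - apply/measurable_EFinP; apply: measurable_funD => //.
      exact: measurable_funM.
    - by move=> w _; rewrite lee_fin f_le.
  apply: le_trans (expR_ge1Dx _).
  rewrite -lee_fin fineK; first exact: Ele.
  apply: (@bounded_integral_fin_num _ _ _ _ _ (expR 3^-1)); first exact: measurableT_comp.
  move=> w; rewrite expR_ge0/= ler_expR.
  exact: le_trans (ler_norm _) (lphi _).
have prodE w : expR (lambda * \sum_i phi (X i w)) = \prod_i f i (X i w).
  by rewrite mulr_sumr expR_sum.
have Eprod : (\int[P]_w (expR (lambda * \sum_i phi (X i w)))%:E <=
    (expR (n%:R * ((lambda + lambda ^+ 2 * L) * mu)))%:E)%E.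
  under eq_integral do rewrite prodE.
  rewrite (@integral_prod_indep _ _ _ P n X f (expR 3^-1) mX indep mf _).
    rewrite lee_fin expRM_natl -[n in X in _ <= X](card_ord n) -prodr_const.
    apply: ler_prod => i _; rewrite Ef andbT; apply/fine_ge0/integral_ge0 => w _.
    by rewrite lee_fin expR_ge0.
  move=> i x; rewrite expR_ge0/= ler_expR.
  exact: le_trans (ler_norm _) (lphi x).
have mS : measurable_fun setT (fun w => lambda * \sum_i phi (X i w)).
  by apply: measurable_funM => //; apply: measurable_sum.
pose mS_mixin := isMeasurableFun.Build _ _ _ _ _ mS.
pose S : {RV P >-> R} := HB.pack (fun w => lambda * \sum_i phi (X i w)) mS_mixin.
(* The Chernoff parameter is 1 because [lambda] is already inside the variable; it may thus be
   negative, and both tails are covered. *)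
apply: le_trans (chernoff S a (@ltr01 R)) _.
rewrite expRD mul1r EFinM; apply: lee_wpmul2r.
  by rewrite lee_fin expR_ge0.
apply: le_trans Eprod; rewrite /mmt_gen_fun unlock le_eqVlt; apply/orP; left; apply/eqP.
by apply: eq_integral => w _ /=; rewrite mulr1.
Qed.

(** The exponential bound is applied to [lambda] and to [- lambda]. The quadratic term lambda^2 L mu
    is at most lambda eps / 2, so half of eps survives in the exponent. *)
Lemma truncated_deviation d0 (Omega : measurableType d0) (R : realType)
    (P : probability Omega R) (n : nat) (X : 'I_n -> Omega -> R)
    (phi : R -> R) (lambda L mu eps : R) :
    (0 < n)%N -> (forall i, measurable_fun setT (X i)) ->
    (forall y : 'I_n -> R, P [set w | forall i, X i w <= y i] =
      (\prod_i fine (P [set w | X i w <= y i]))%:E) ->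
    measurable_fun setT phi -> (forall x, 0 <= phi x <= L) ->
    (forall i, (\int[P]_w (phi (X i w))%:E = mu%:E)%E) ->
    0 < lambda -> lambda * L <= 3^-1 -> lambda * L * mu <= eps / 2 ->
  (P [set w | (eps <= `|n%:R^-1 * (\sum_i phi (X i w)) - mu|)%R] <=
   (2 * expR (- (n%:R * lambda * (eps / 2))))%:E)%E.
Proof.
move=> n0 mX indep mphi phiL Emu l0 lL lLmu.
have nn0 : 0 < n%:R :> R by rewrite ltr0n.
pose U (l b : R) := [set w | (n%:R * b <= l * \sum_i phi (X i w))%R].
have mU l b : measurable (U l b).
  apply: measurable_le_fun => //; apply: measurable_funM => //.
  by apply: measurable_sum => i; exact: measurableT_comp.
have bound (l b : R) : `|l| = lambda -> b = l * mu + lambda * eps ->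
    (P (U l b) <= (expR (- (n%:R * lambda * (eps / 2))))%:E)%E.
  move=> ll bE.
  have lL' : `|l| * L <= 3^-1 by rewrite ll.
  apply: le_trans (chernoff_bounded_indep (n%:R * b) mX indep mphi phiL Emu lL') _.
  have l2 : l ^+ 2 = lambda ^+ 2 by rewrite -[LHS]real_normK ?num_real// ll.
  rewrite lee_fin ler_expR bE l2 -mulrBr -(mulrA n%:R lambda) -mulrN ler_pM2l//.
  have := ler_wpM2l (ltW l0) lLmu; rewrite expr2; lra.
pose UU := U lambda (lambda * mu + lambda * eps) `|`
  U (- lambda) (- lambda * mu + lambda * eps).
apply: le_trans (_ : P UU <= _)%E.
  apply: le_measure; rewrite ?inE.
  - apply: measurable_le_fun => //; apply: measurableT_comp => //.
    apply: measurable_funB => //; apply: measurable_funM => //.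
    by apply: measurable_sum => i; exact: measurableT_comp.
  - by apply: measurableU; exact: mU.
  rewrite /UU => w /=; set S := \sum_i _; rewrite /U/= -/S.
  have SE : S = n%:R * (n%:R^-1 * S) by rewrite mulrA mulfV ?mul1r// gt_eqF.
  have nl : 0 <= n%:R * lambda by rewrite mulr_ge0// ltW.
  rewrite ler_normr => /orP[] h; [left|right]; rewrite SE;
    have := ler_wpM2l nl h; move: (n%:R^-1 * S) => Z; lra.
apply: le_trans (measureU2 _ _ _) _ => //; rewrite ?mU//.
rewrite mulr_natl mulr2n EFinD; apply: leeD; apply: bound => //; first exact: gtr0_norm.
by rewrite normrN gtr0_norm.
Qed.

(** After division by (k + 2)^(- delta) the claim is (1 - 1/(k + 2))^(- delta) >= 1 + delta / (k +
    2), which follows from - ln(1 - y) >= y and exp(x) >= 1 + x. It gives explicit partial sums for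
    the series of N^(-p). *)
Lemma powR_telescope_le (R : realType) (delta : R) (k : nat) : 0 < delta ->
  delta * k.+2%:R `^ (- (1 + delta)) <= k.+1%:R `^ (- delta) - k.+2%:R `^ (- delta).
Proof.
move=> d0.
have k1 : 0 < k.+1%:R :> R by rewrite ltr0n.
have k2 : 0 < k.+2%:R :> R by rewrite ltr0n.
have x0 : 0 < k.+1%:R / k.+2%:R :> R by rewrite divr_gt0.
have e2 : k.+1%:R `^ (- delta) =
    k.+2%:R `^ (- delta) * (k.+1%:R / k.+2%:R : R) `^ (- delta).
  by rewrite -powRM ?(ltW x0) ?(ltW k2)// mulrCA mulfV ?mulr1// gt_eqF.
have e1 : k.+2%:R `^ (- (1 + delta)) = k.+2%:R `^ (- delta) / k.+2%:R :> R.
  rewrite opprD powRD ?(gt_eqF k2) ?implybT// powR_inv1 ?(ltW k2)//.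
  exact: mulrC.
have h : 1 + delta / k.+2%:R <= (k.+1%:R / k.+2%:R : R) `^ (- delta).
  rewrite /powR gt_eqF//; apply: le_trans (expR_ge1Dx _).
  rewrite lerD2l mulNr -mulrN ler_pM2l// -lnV ?posrE// invf_div.
  have y0 : 0 < k.+2%:R / k.+1%:R :> R by rewrite divr_gt0.
  rewrite -ler_expR lnK ?posrE//.
  rewrite -[leRHS]invrK -[leLHS]invrK lef_pV2 ?posrE ?invr_gt0 ?expR_gt0//.
  rewrite -expRN; apply: le_trans (expR_ge1Dx _).
  rewrite invf_div le_eqVlt; apply/orP; left; apply/eqP.
  have -> : k.+1%:R = k.+2%:R - 1 :> R by rewrite -[X in _ = X - _]natr1 addrK.
  by rewrite mulrBl mulfV ?gt_eqF// div1r.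
rewrite e1 e2 [delta * _]mulrCA lerBrDl.
by have := ler_wpM2l (powR_ge0 (k.+2%:R : R) (- delta)) h; rewrite mulrDr mulr1.
Qed.

Lemma borel_cantelli_powR d0 (Omega : measurableType d0) (R : realType)
    (P : probability Omega R) (F : nat -> set Omega) (K p : R) :
    (forall N, measurable (F N)) -> 0 <= K -> 1 < p ->
    (\forall N \near \oo, (P (F N) <= (K * N%:R `^ (- p))%:E)%E) ->
  {ae P, forall w, \forall N \near \oo, ~ F N w}.
Proof.
move=> mF K0 p1 [N0 _ FK].
have d0' : 0 < p - 1 by rewrite subr_gt0.
(* Early events are emptied: the bound holds only from [N0] on, and the telescoping starts at index
   2. The upper limit of the sets is unchanged. *)
pose F' N := if (maxn N0 2 <= N)%N then F N else set0.
have mF' N : measurable (F' N) by rewrite /F'; case: ifP.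
have sumF : (\sum_(N <oo) P (F' N) <= (K / (p - 1))%:E)%E.
  apply: lime_le; first exact: is_cvg_nneseries.
  near=> M.
  have [k ->] : exists k, M = k.+2.
    exists M.-2; rewrite -[LHS](@subnK 2 M) ?addn2 ?subn2//.
    by near: M; exact: nbhs_infty_ge.
  apply: le_trans (_ : (K / (p - 1) * (1 - k.+1%:R `^ (- (p - 1))))%:E <= _)%E; last first.
    rewrite lee_fin ler_piMr ?divr_ge0 ?(ltW d0')//.
  elim: k => [|k IH].
    rewrite big_mkord big1; last first.
      by move=> i _; rewrite /F' leqNgt (leq_trans (ltn_ord i) (leq_maxr _ _))/= measure0.
    by rewrite powR1 subrr mulr0.
  rewrite big_nat_recr//=; apply: le_trans (leeD IH (_ : _ <= (K * k.+2%:R `^ (- p))%:E)%E) _.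
    rewrite /F'; case: ifPn => [h|_]; last by rewrite measure0 lee_fin mulr_ge0 ?powR_ge0.
    by apply: FK; rewrite /=; apply: leq_trans h; exact: leq_maxl.
  rewrite -EFinD lee_fin.
  have := powR_telescope_le k d0'; rewrite [1 + _]addrC subrK => h.
  have : K * k.+2%:R `^ (- p) <= K / (p - 1) * (k.+1%:R `^ (- (p - 1)) - k.+2%:R `^ (- (p - 1))).
    rewrite -mulrA ler_wpM2l// -ler_pdivrMl ?invr_gt0// invrK.
    exact: h.
  lra.
have : P (lim_sup_set F') = 0%E.
  by apply: lim_sup_set_cvg0 => //; apply: le_lt_trans sumF _; exact: ltry.
move=> limF; exists (lim_sup_set F'); split => //.
  by apply: bigcapT_measurable => n; apply: bigcup_measurable => k _.
move=> w /= H k _; apply: contrapT => Hk; apply: H.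
exists (maxn k (maxn N0 2)) => // j /= kj Fj; apply: Hk.
exists j => //=; first by apply: leq_trans kj; exact: leq_maxl.
by rewrite /F' (leq_trans _ kj)// leq_maxr.
Unshelve. all: by end_near. Qed.

(** Differentiability of the power settles l > 0. The case l = 0, which occurs when sigma(S) = 0, is
    settled by the threshold e^(1/q). *)
Lemma cvg_powR (R : realType) (u : R^nat) (l q : R) : 0 < q ->
    (forall n, 0 <= u n) -> u @ \oo --> l ->
  u n `^ q @[n --> \oo] --> l `^ q.
Proof.
move=> q0 u0 ul.
have l0 : 0 <= l by apply: (@cvgr_to_ge _ _ _ _ _ _ _ ul); exact: nearW.
move: l0; rewrite le_eqVlt => /predU1P[l0|l0]; last first.
  apply: (@continuous_cvg _ _ _ _ _ u (fun x : R => x `^ q)) => //.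
  apply: differentiable_continuous; apply/derivable1_diffP.
  by apply: derivable_powR; rewrite in_itv/= andbT.
rewrite -l0 powR0 ?gt_eqF//; rewrite -l0 in ul.
apply/cvgrPdist_lt => e e0; near=> n.
rewrite sub0r normrN ger0_norm ?powR_ge0//.
have eE : e = (e `^ q^-1) `^ q by rewrite -powRrM mulVf ?gt_eqF// powRr1// ltW.
rewrite eE; apply: (gt0_ltr_powR q0); rewrite ?nnegrE ?powR_ge0//.
by near: n; apply: (cvgr_lt _ ul); exact: powR_gt0.
Unshelve. all: by end_near. Qed.

(** * Group maxima *)

Lemma grouped_indep d0 d1 (Omega : measurableType d0) (E : measurableType d1)
    (R : realType) (P : probability Omega R) (xi : nat -> {RV P >-> E})
    (N n m : nat) (G : 'I_n -> {set 'I_N}) (B : 'I_n -> set E) :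
    iid xi -> is_grouping m G -> (forall i, measurable (B i)) ->
  P [set w | forall (i : 'I_n) (k : 'I_N), k \in G i -> B i (xi k.+1 w)] =
  (\prod_i fine (P (xi 0%N @^-1` B i)) ^+ m)%:E.
Proof.
move=> [indep idd] [Gm Gdisj] mB.
(* Conditions on groups become conditions on sample indices: [B' k.+1] is [B i] for [k] in [G i],
   unambiguous by disjointness, and is [setT] for leftover vectors. *)
pose B' (j : nat) := [set x | forall (k : 'I_N) i, k.+1 = j -> k \in G i -> B i x].
have B'E (k : 'I_N) i : k \in G i -> B' k.+1 = B i.
  move=> kG; apply/seteqP; split => x /=; first by move=> /(_ k i); apply.
  by move=> Bx l j [] /ord_inj -> /Gdisj /(_ kG) ->.
have B'T j : (forall (k : 'I_N) i, k.+1 = j -> k \notin G i) -> B' j = setT.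
  move=> H; apply/seteqP; split => x // _ k i kj.
  by rewrite (negbTE (H _ _ kj)).
have mB' j : measurable (B' j).
  have [[k [i [<- kG]]]|H] := pselect (exists (k : 'I_N) i, k.+1 = j /\ k \in G i).
    by rewrite (B'E _ _ kG).
  rewrite B'T// => k i kj; apply/negP => kG; apply: H.
  by exists k, i.
(* The sample has indices 1 to N; index 0, the generic vector, only serves as reference for the
   common law. *)
have [J JE] : exists J : {fset nat}, J =i iota 1 N.
  by exists (seq_fset tt (iota 1 N)) => j; rewrite seq_fsetE.
have PE j C : measurable C -> P (xi j @^-1` C) = P (xi 0%N @^-1` C).
  by move=> mC; exact: (idd j 0%N C mC).
have fP C : measurable C -> (fine (P (xi 0%N @^-1` C)))%:E = P (xi 0%N @^-1` C).
  move=> mC; rewrite fineK// fin_num_measure//.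
  by rewrite -[X in measurable X]setTI; exact: (measurable_funP (xi 0%N)).
transitivity (P (\bigcap_(j in [set` J]) (xi j @^-1` B' j))).
  congr (P _); apply/seteqP; split => w /= H.
    by move=> j _ k i <- kG; exact: H.
  move=> i k kG; apply: (H k.+1) => //=.
  by rewrite JE mem_iota/= add1n ltnS.
rewrite indep// (perm_big (iota 1 N)); last first.
  by apply: uniq_perm; rewrite ?iota_uniq ?fset_uniq.
under eq_bigr do rewrite PE// -fP//.
rewrite -(big_morph EFin (@EFinM R) erefl); congr (_%:E).
rewrite -[iota 1 N]/(iota (1 + 0) N) iotaDl big_map -[N in iota _ N]subn0.
rewrite -/(index_iota 0 N) big_mkord.
(* Each inner product has at most one factor, and is empty for a leftover vector; exchanging the
   products then collects the m factors of each group. *)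
transitivity (\prod_(k < N) \prod_(i | k \in G i) fine (P (xi 0%N @^-1` B i))).
  apply: eq_bigr => k _; rewrite add1n.
  have [[i kG]|H] := pselect (exists i, k \in G i).
    rewrite (B'E _ _ kG) (big_pred1 i)// => j /=.
    by apply/idP/eqP => [kj|->//]; exact: Gdisj kj kG.
  rewrite B'T ?preimage_setT ?probability_setT; last first.
    by move=> l i [] /ord_inj ->; apply/negP => kG; apply: H; exists i.
  by rewrite big_pred0// => i; apply/negP => kG; apply: H; exists i.
rewrite (exchange_big_dep xpredT)//=; apply: eq_bigr => i _.
by rewrite prodr_const Gm.
Qed.

Lemma enorm_ge0 (R : realType) d (x : 'rV[R]_d) : 0 <= enorm x.
Proof. exact: sqrtr_ge0. Qed.

Lemma enorm_continuous (R : realType) d : continuous (@enorm R d.+1).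
Proof.
have cS : continuous (fun x : 'rV[R]_d.+1 => \sum_(i < d.+1) x ord0 i ^+ 2).
  apply: continuous_big => [|i _ x]; first exact: add_continuous.
  apply: (@continuous_comp _ _ _ (fun x : 'rV[R]_d.+1 => x ord0 i) (fun z => z ^+ 2)).
    exact: coord_continuous.
  exact: exprn_continuous.
move=> x; apply: (@continuous_comp _ _ _
  (fun x : 'rV[R]_d.+1 => \sum_(i < d.+1) x ord0 i ^+ 2) Num.sqrt).
  exact: cS.
exact: sqrt_continuous.
Qed.

Lemma measurable_enorm_le (R : realType) d (y : R) :
  measurable ([set x : borel 'rV[R]_d.+1 | enorm (x : 'rV[R]_d.+1) <= y]).
Proof.
rewrite (_ : [set x | _] = ~` [set x : 'rV[R]_d.+1 | y < enorm x]); last first.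
  by apply/seteqP; split => x /=; rewrite leNgt => /negP.
apply: measurableC; apply: sub_sigma_algebra.
rewrite (_ : [set x | _] = @enorm R d.+1 @^-1` `]y, +oo[); last first.
  by apply/seteqP; split => x /=; rewrite in_itv/= andbT.
apply: open_comp; last exact: interval_open.
by move=> x _; exact: enorm_continuous.
Qed.

Lemma measurable_enorm (R : realType) d :
  measurable_fun setT (@enorm R d.+1 : borel 'rV[R]_d.+1 -> R).
Proof.
apply: (measurability (@RGenOInfty.G R)); first exact: RGenOInfty.measurableE.
move=> _ [_ [x ->] <-]; rewrite setTI -setCitvl preimage_setC; apply: measurableC.
rewrite [X in measurable X](_ : _ =
    [set z : borel 'rV[R]_d.+1 | enorm (z : 'rV[R]_d.+1) <= x]).
  exact: measurable_enorm_le.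
by apply/seteqP; split => z /=; rewrite in_itv.
Qed.

Section group_maxima.
Context d0 (Omega : measurableType d0) (R : realType) (P : probability Omega R).
Context (d : nat) (xi : nat -> {RV P >-> borel 'rV[R]_d.+1}).
Hypothesis xi_iid : iid xi.
Context (N n m : nat) (G : 'I_n -> {set 'I_N}).
Hypothesis G_grouping : is_grouping m G.
Hypothesis m_gt0 : (0 < m)%N.

Let M i w := group_max (fun k => xi k w : 'rV[R]_d.+1) G i.
Let p y := fine (P [set w | enorm (xi 0%N w : 'rV[R]_d.+1) <= y]).

Lemma group_max_ge0 i w : 0 <= M i w.
Proof.
rewrite /M /group_max; elim/big_ind: _ => // [x y x0 y0|k _]; last exact: enorm_ge0.
by rewrite le_max x0.
Qed.

Lemma group_max_le i w y :
  M i w <= y <-> forall k, k \in G i -> enorm (xi k.+1 w : 'rV[R]_d.+1) <= y.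
Proof.
split => [My k kG|H].
  by apply: le_trans My; rewrite /M /group_max (bigD1 k)//= le_max lexx.
(* The maximum starts at 0, so for y < 0 the equivalence would fail on an empty group; a member of
   the group forces y >= 0. *)
have : (0 < #|G i|)%N by rewrite G_grouping.1.
move=> /card_gt0P[k kG].
have y0 : 0 <= y by apply: le_trans (H k kG); exact: enorm_ge0.
rewrite /M /group_max; elim/big_ind: _ => // a b ay by_.
by rewrite ge_max ay.
Qed.

Lemma group_max_joint_cdf (y : 'I_n -> R) :
  P [set w | forall i, M i w <= y i] = (\prod_i p (y i) ^+ m)%:E.
Proof.
pose B (i : 'I_n) := [set x : borel 'rV[R]_d.+1 | enorm (x : 'rV[R]_d.+1) <= y i].
rewrite -(grouped_indep (B := B) xi_iid G_grouping); last first.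
  by move=> i; exact: measurable_enorm_le.
congr (P _); apply/seteqP; split => w /= H i; first exact/group_max_le.
by apply/group_max_le; exact: H.
Qed.

(** A marginal law is the joint law with the other groups left unconstrained, hence [setT] for their
    sets. *)
Lemma group_max_cdf i y : P [set w | M i w <= y] = (p y ^+ m)%:E.
Proof.
pose B (j : 'I_n) := if j == i then
  [set x : borel 'rV[R]_d.+1 | enorm (x : 'rV[R]_d.+1) <= y] else setT.
have mB j : measurable (B j).
  by rewrite /B; case: eqP => // _; exact: measurable_enorm_le.
transitivity ((\prod_j fine (P (xi 0%N @^-1` B j)) ^+ m)%:E).
  rewrite -(grouped_indep xi_iid G_grouping mB).
  congr (P _); apply/seteqP; split => w /=.
    move=> /group_max_le H j k kG; rewrite /B; case: eqP => // ji.
    by apply: H; rewrite -ji.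
  move=> H; apply/group_max_le => k kG; have := H i k kG.
  by rewrite /B eqxx.
congr (_%:E); rewrite (bigD1 i)//= big1 ?mulr1; last first.
  by move=> j /negPf ji; rewrite /B ji preimage_setT probability_setT expr1n.
by rewrite /B eqxx.
Qed.

Lemma group_max_indep (y : 'I_n -> R) :
  P [set w | forall i, M i w <= y i] = (\prod_i fine (P [set w | M i w <= y i]))%:E.
Proof.
by rewrite group_max_joint_cdf; under [in RHS]eq_bigr do rewrite group_max_cdf.
Qed.

Lemma measurable_group_max i : measurable_fun setT (M i).
Proof.
suff h (s : seq 'I_N) : measurable_fun setT
    (fun w => \big[Num.max/0]_(k <- s) enorm (xi k.+1 w : 'rV[R]_d.+1)).
  rewrite /M /group_max (_ : (fun w => _) = fun w =>
      \big[Num.max/0]_(k <- enum (G i)) enorm (xi k.+1 w : 'rV[R]_d.+1)) //.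
  by apply/funext => w; rewrite big_enum.
elim: s => [|k s IH].
  by under eq_fun do rewrite big_nil; exact: measurable_cst.
under eq_fun do rewrite big_cons.
apply: measurable_maxr => //.
apply: (measurableT_comp (@measurable_enorm R d)).
exact: measurable_funP.
Qed.

End group_maxima.

(** Layer cake with weight 1: for z < L, the event that the truncated power exceeds z is that [X]
    exceeds z^(1/t) m^(1/alpha), by monotonicity of the power. *)
Lemma integral_truncated_max d0 (Omega : measurableType d0) (R : realType)
    (P : probability Omega R) (X : Omega -> R) (T : R -> R) (alpha t L : R) (m : nat) :
    measurable_fun setT X -> (forall w, 0 <= X w) -> measurable_fun setT T ->
    0 <= L -> 0 < t -> (0 < m)%N ->
    (forall y, P [set w | X w <= y] = ((1 - T y) ^+ m)%:E) ->
  (\int[P]_w (Num.min ((X w / m%:R `^ alpha^-1) `^ t) L)%:E =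
   \int[lebesgue_measure]_(z in `]0%R, +oo[) (truncated_tail T alpha t m L z)%:E)%E.
Proof.
move=> mX X0 mT L0 t0 m0 PX.
have a0 : 0 < m%:R `^ alpha^-1 :> R by rewrite powR_gt0// ltr0n.
pose h w := Num.min ((X w / m%:R `^ alpha^-1) `^ t) L.
have mh : measurable_fun setT h.
  apply: measurable_minr => //.
  apply: (measurableT_comp (measurable_powR t)).
  exact: measurable_funM.
have h0 w : 0 <= h w by rewrite le_min powR_ge0.
have mtt : measurable_fun setT (fun z => (truncated_tail T alpha t m L z)%:E).
  apply/measurable_EFinP; exact: measurable_truncated_tail.
have := @integral_layer_cake _ _ _ P (cst 1) h (measurable_cst _) (fun=> ler01) mh h0.
under eq_integral do rewrite mul1r.
move=> ->; rewrite integral_itv_obnd_cbnd; last exact: measurable_funTS.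
apply: eq_integral => z; rewrite inE/= in_itv/= andbT => z0.
have -> : (\int[P]_(w in [set w | (z < h w)%R]) (cst 1 w : R)%:E =
    P [set w | (z < h w)%R])%E.
  rewrite (eq_integral (cst 1%E))// integral_cst// ?mul1e//.
  exact: measurable_lt_fun.
rewrite /truncated_tail; case: ifPn => [zL|]; last first.
  rewrite -leNgt => Lz; rewrite (_ : [set w | _] = set0) ?measure0//.
  by apply/seteqP; split => w //=; rewrite /h lt_min => /andP[_]; rewrite ltNge Lz.
have zE : z = (z `^ t^-1) `^ t by rewrite -powRrM mulVf ?gt_eqF// powRr1.
set y := z `^ t^-1 * _.
have mle : measurable [set w | X w <= y] by exact: measurable_le_fun.
rewrite EFinB -PX -probability_setC//; congr (P _).
apply/seteqP; split => w /=; rewrite /h lt_min zL andbT zE ltNge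
  gt0_powR_le ?powR_ge0 ?divr_ge0 ?(ltW a0)// ler_pdivrMr// => /negP//.
Qed.

Lemma enormZ (R : realType) d (k : R) (x : 'rV[R]_d) : enorm (k *: x) = `|k| * enorm x.
Proof.
rewrite /enorm -sqrtr_sqr -sqrtrM ?sqr_ge0// mulr_sumr; congr Num.sqrt.
by apply: eq_bigr => i _; rewrite mxE exprMn.
Qed.

Lemma measurable_norm_gt (R : realType) (d : nat)
    (d0 : measure_display) (Omega : measurableType d0) (P : probability Omega R)
    (xi : {RV P >-> borel 'rV[R]_d.+1}) (y : R) :
  measurable [set w | y < enorm (xi w : 'rV[R]_d.+1)].
Proof.
have mX : measurable_fun setT (fun w => enorm (xi w : 'rV[R]_d.+1)).
  by apply: (measurableT_comp (@measurable_enorm R d)); exact: measurable_funP.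
exact: measurable_lt_fun.
Qed.

(** The whole sphere has empty boundary, and the strict inequality forces a positive norm, so the
    direction lies on the sphere automatically. *)
Lemma norm_tail_cvg (R : realType) (d : nat)
    (d0 : measure_display) (Omega : measurableType d0) (P : probability Omega R)
    (alpha : R) (sigma : {finite_measure set (borel (usphere R d)) -> \bar R})
    (xi : {RV P >-> borel 'rV[R]_d.+1}) (rho : R) :
    regularly_varying_tail P xi alpha sigma -> 0 < rho ->
  n%:R * fine (P [set w | rho * n%:R `^ alpha^-1 < enorm (xi w : 'rV[R]_d.+1)])
    @[n --> \oo] --> fine (sigma setT) * rho `^ (- alpha).
Proof.
move=> tail rho0.
have bT : sigma (boundary (setT : set (usphere R d))) = 0%E.
  by rewrite /boundary interiorT setDT measure0.
have := tail rho setT rho0 measurableT bT.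
have sfin : sigma setT \is a fin_num by rewrite fin_num_measure.
rewrite -{1}(fineK sfin) -EFinM => /fine_cvg.
apply: cvg_trans; apply: near_eq_cvg; apply: nearW => n /=.
set A := [set w | _]; set B := [set w | _].
have -> : A = B.
  apply/seteqP; split => w; rewrite /A/B/=; first by case.
  move=> h; split => //.
  have e0 : 0 < enorm (xi w : 'rV[R]_d.+1).
    by apply: le_lt_trans h; rewrite mulr_ge0 ?powR_ge0// ltW.
  have e1 : enorm ((enorm (xi w : 'rV[R]_d.+1))^-1 *: (xi w : 'rV[R]_d.+1)) = 1.
    by rewrite enormZ ger0_norm ?invr_ge0 ?(ltW e0)// mulVf// gt_eqF.
  have e2 : (enorm (xi w : 'rV[R]_d.+1))^-1 *: (xi w : 'rV[R]_d.+1) \in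
    [set x : 'rV[R]_d.+1 | enorm x = 1] by exact: mem_set.
  by exists (SigSub e2 : usphere R d).
by rewrite fineM// fin_num_measure//; exact: measurable_norm_gt.
Qed.

(** * Consistency of the estimator *)

Lemma powRn_cvgy (R : realType) (q : R) : 0 < q ->
  n%:R `^ q @[n --> \oo] --> +oo.
Proof.
move=> q0; apply/cvgryPge => A; near=> n.
apply: (@le_trans _ _ (Num.max A 0)); first by rewrite le_max lexx.
have M0 : 0 <= Num.max A 0 by rewrite le_max lexx orbT.
have -> : Num.max A 0 = (Num.max A 0 `^ q^-1) `^ q.
  by rewrite -powRrM mulVf ?gt_eqF// powRr1.
apply: (ge0_ler_powR (ltW q0)); rewrite ?nnegrE ?powR_ge0 ?ler0n//.
by near: n; exact: nbhs_infty_ger.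
Unshelve. all: by end_near. Qed.

Lemma group_countP (R : realType) (r : R) (N : nat) : 0 < r -> (0 < N)%N ->
  [/\ (0 < group_count r N)%N, (group_count r N)%:R <= N%:R `^ r
    & N%:R `^ r <= 2 * (group_count r N)%:R].
Proof.
move=> r0 N0; have Nr1 : 1 <= N%:R `^ r :> R.
  by rewrite -[leLHS](powRr0 (N%:R : R)) ler_powR ?ler1n// ltW.
have n1 : (0 < group_count r N)%N by rewrite truncn_gt0.
split => //; first by rewrite truncn_le// (le_trans _ Nr1).
apply: ltW; apply: lt_le_trans (truncnS_gt _) _.
by rewrite -natrM ler_nat mul2n -addnn -addn1 leq_add2l.
Qed.

Lemma group_size_gt0 (R : realType) (r : R) (N : nat) : 0 < r -> r < 1 ->
  (0 < N)%N -> (0 < group_size r N)%N.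
Proof.
move=> r0 r1 N0; have [n1 nN _] := group_countP r0 N0.
rewrite divn_gt0// -(ler_nat R); apply: le_trans nN _.
by rewrite -[leRHS](@powRr1 R)// ler_powR ?ler1n// ltW.
Qed.

Lemma group_size_cvgy (R : realType) (r : R) : 0 < r -> r < 1 ->
  group_size r N @[N --> \oo] --> \oo.
Proof.
move=> r0 r1; apply/cvgnyPge => A; near=> N.
have N0 : (0 < N)%N by near: N; exact: nbhs_infty_gt.
have [n1 nN _] := group_countP r0 N0.
rewrite /group_size leq_divRL// -(ler_nat R) natrM.
apply: le_trans (ler_wpM2l _ nN) _ => //.
have NE : N%:R = N%:R `^ (1 - r) * N%:R `^ r :> R.
  by rewrite -powRD ?subrK ?powRr1// pnatr_eq0 -lt0n N0 implybT.
rewrite [leRHS]NE.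
apply: ler_wpM2r; first exact: powR_ge0.
near: N; apply: (cvgry_ge (powRn_cvgy _)).
by rewrite subr_gt0.
Unshelve. all: by end_near. Qed.

(** One term of the exponential series. It turns exp(- const N^delta) into a power of N, so that a
    single Borel-Cantelli statement serves both kinds of bad event. *)
Lemma expRN_le_powR (R : realType) (x : R) (k : nat) : 0 < x ->
  expR (- x) <= (k.+1)`!%:R * x ^- k.+1.
Proof.
move=> x0; rewrite expRN -[leRHS]invrK lef_pV2 ?posrE ?expR_gt0 ?invr_gt0 ?mulr_gt0
  ?invr_gt0 ?exprn_gt0 ?ltr0n ?fact_gt0//.
rewrite invfM invrK mulrC.
by have := expR_ge1Dxn k (ltW x0); lra.
Qed.

Section sigma_hat_consistency.
Unset Implicit Arguments.
Context (R : realType) (d : nat) (d0 : measure_display) (Omega : measurableType d0).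
Context (P : probability Omega R) (alpha : R) (alpha_gt0 : 0 < alpha).
Context (sigma : {finite_measure set (borel (usphere R d)) -> \bar R}).
Context (xi : nat -> {RV P >-> borel 'rV[R]_d.+1}).
Hypothesis xi_iid : iid xi.
Hypothesis xi_tail : regularly_varying_tail P (xi 0%N) alpha sigma.
Context (r : R) (r_gt0 : 0 < r) (r_lt1 : r < 1).
Context (G : forall N : nat, 'I_(group_count r N) -> {set 'I_N}).
Hypothesis G_grouping : forall N : nat, is_grouping (group_size r N) (@G N).
Context (t : R) (t_gt0 : 0 < t) (t_lt : t < alpha * r / 2).

Let n N := group_count r N.
Let m N := group_size r N.
Let c := fine (sigma setT).
Let T (x : R) := fine (P [set w | x < enorm (xi 0%N w : 'rV[R]_d.+1)]).
Let X N (i : 'I_(n N)) w := group_max (fun k => xi k w : 'rV[R]_d.+1) (@G N) i.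

Let s_lt : t / alpha < r / 2.
Proof. by rewrite ltr_pdivrMr// mulrC mulrA. Qed.

Let s_gt0 : 0 < t / alpha. Proof. by rewrite divr_gt0. Qed.

(* b and a split ]b0, r[ evenly: b > b0 makes the truncation probability
   summable, a > b makes the exponential inequality sharp and a < r makes its
   bound summable. *)
Let b0 := t / alpha * (1 + r).
Let b := (2 * b0 + r) / 3.
Let a := (b0 + 2 * r) / 3.

Let b0_lt : b0 < r.
Proof.
have r1 : 0 < 1 + r by rewrite addr_gt0.
have : b0 < r / 2 * (1 + r) by rewrite /b0 ltr_pM2r.
have : r * r < r by rewrite gtr_pMr.
lra.
Qed.

Let L N : R := N%:R `^ b.
Let lambda N : R := N%:R `^ (- a).

Let T01 x : 0 <= T x <= 1.
Proof.
rewrite fine_ge0//= -lee_fin fineK ?probability_le1 ?fin_num_measure//;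
  exact: measurable_norm_gt.
Qed.

Let T_noninc : {homo T : x y / x <= y >-> y <= x}.
Proof.
move=> x y xy; rewrite fine_le ?fin_num_measure//; try exact: measurable_norm_gt.
apply: le_measure; rewrite ?inE; try exact: measurable_norm_gt.
by move=> w /=; exact: le_lt_trans.
Qed.

Let T_measurable : measurable_fun setT T.
Proof. by apply: nonincreasing_measurable => // x y; exact: T_noninc. Qed.

Let T_cvg rho : 0 < rho ->
  k%:R * T (rho * k%:R `^ alpha^-1) @[k --> \oo] --> c * rho `^ (- alpha).
Proof. by move=> rho0; exact: norm_tail_cvg. Qed.

Let cdf_T y : fine (P [set w | enorm (xi 0%N w : 'rV[R]_d.+1) <= y]) = 1 - T y.
Proof.
rewrite (_ : [set w | _] = ~` [set w | y < enorm (xi 0%N w : 'rV[R]_d.+1)]); last first.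
  by apply/seteqP; split => x /=; rewrite leNgt => /negP.
by rewrite probability_setC ?fineB ?fin_num_measure//; exact: measurable_norm_gt.
Qed.

Let phi N (x : R) := Num.min ((x / (m N)%:R `^ alpha^-1) `^ t) (L N).
(** The common mean of the truncated variables, written as a tail integral so that it carries no
    group index and its limit can be taken directly. *)
Let mu N := fine (\int[lebesgue_measure]_(z in `]0%R, +oo[)
  (truncated_tail T alpha t (m N) (L N) z)%:E)%E.
Let avg N w := (n N)%:R^-1 * \sum_i phi N (X N i w).
(* X > height if and only if the normalized maximum to the power t exceeds L. *)
Let height N := L N `^ t^-1 * (m N)%:R `^ alpha^-1.
Let limit := c `^ (t / alpha) * Gamma (1 - t / alpha).
Let bad eps N := [set w | exists i, height N < X N i w] `|`
  [set w | eps <= `|avg N w - mu N|].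

Let X_measurable N i : measurable_fun setT (X N i).
Proof. exact: measurable_group_max. Qed.

Let X_ge0 N i w : 0 <= X N i w.
Proof. exact: group_max_ge0. Qed.

Let X_cdf N i y : (0 < N)%N -> P [set w | X N i w <= y] = ((1 - T y) ^+ m N)%:E.
Proof.
move=> N0; rewrite -cdf_T.
by apply: group_max_cdf => //; exact: group_size_gt0.
Qed.

Let X_indep N (y : 'I_(n N) -> R) : (0 < N)%N ->
  P [set w | forall i, X N i w <= y i] = (\prod_i fine (P [set w | X N i w <= y i]))%:E.
Proof. by move=> N0; apply: group_max_indep => //; exact: group_size_gt0. Qed.

Let phi_measurable N : measurable_fun setT (phi N).
Proof.
apply: measurable_minr => //; apply: (measurableT_comp (measurable_powR t)).
exact: measurable_funM.
Qed.

Let phi_bound N x : 0 <= phi N x <= L N.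
Proof. by rewrite /phi le_min !powR_ge0/= ge_min lexx orbT. Qed.

Let phi_mean N i : (0 < N)%N -> (\int[P]_w (phi N (X N i w))%:E = (mu N)%:E)%E.
Proof.
move=> N0.
have E := integral_truncated_max alpha (X_measurable N i) (X_ge0 N i)
  T_measurable (powR_ge0 _ _ : 0 <= L N) t_gt0 (group_size_gt0 r_gt0 r_lt1 N0)
  (fun y => X_cdf N i y N0).
rewrite /mu -E fineK//; apply: (@bounded_integral_fin_num _ _ _ _ _ (L N)).
  exact: (measurableT_comp (phi_measurable N) (X_measurable N i)).
by move=> w; exact: phi_bound.
Qed.

Let b_gt0 : 0 < b.
Proof.
have b00 : 0 < b0 by rewrite mulr_gt0// addr_gt0.
by rewrite /b divr_gt0// addr_gt0// mulr_gt0.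
Qed.

Let t_lt_alpha : t < alpha.
Proof. by rewrite -[ltRHS]mul1r -ltr_pdivrMr//; have := s_lt; have := r_lt1; lra. Qed.

Let tail_bound : exists2 C, 0 < C & forall x, 0 < x -> T x <= C * x `^ (- alpha).
Proof.
apply: (@regular_tail_bound _ _ _ c) => //.
have := T_cvg 1 ltr01; rewrite powR1 mulr1.
by under eq_fun do rewrite mul1r.
Qed.

Let c_ge0 : 0 <= c.
Proof. exact: fine_ge0. Qed.

Let mu_cvg : mu @ \oo --> limit.
Proof.
have [C C0 TC] := tail_bound.
apply: fine_cvg.
exact: (truncated_tail_cvg alpha_gt0 t_gt0 t_lt_alpha c_ge0 (ltW C0) T_measurable T01 TC
  T_cvg (group_size_cvgy r_gt0 r_lt1) (powRn_cvgy b_gt0)).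
Qed.

Let exceedE N : [set w | exists i, height N < X N i w] =
  ~` [set w | forall i, X N i w <= height N].
Proof.
apply/seteqP; split => w /=.
  by move=> [i hi] /(_ i); rewrite leNgt hi.
by move=> /existsNP[i /negP]; rewrite -ltNge => hi; exists i.
Qed.

Let below_measurable N y : measurable [set w | forall i, X N i w <= y].
Proof.
rewrite (_ : [set w | _] = \bigcap_(i in [set: 'I_(n N)]) [set w | X N i w <= y]).
  apply: fin_bigcap_measurable => // i _.
  by apply: measurable_le_fun => //; exact: X_measurable.
by apply/seteqP; split => w /= H i; [move=> _; exact: H|exact: H].
Qed.

Let deviation_measurable eps N : measurable [set w | eps <= `|avg N w - mu N|].
Proof.
apply: measurable_le_fun => //; apply: measurableT_comp => //.
apply: measurable_funB => //; apply: measurable_funM => //.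
apply: measurable_sum => i.
exact: (measurableT_comp (phi_measurable N) (X_measurable N i)).
Qed.

Let bad_measurable eps N : measurable (bad eps N).
Proof.
apply: measurableU => //; rewrite exceedE; apply: measurableC.
exact: below_measurable.
Qed.

(** All groups stay below [height N] with probability (1 - v)^n, where v is the exceedance
    probability of one group. The complement is at most n v, with n <= N^r and v <= C L^(- alpha /
    t) whatever the group size. *)
Let exceed_prob C N : (forall x, 0 < x -> T x <= C * x `^ (- alpha)) -> (0 < N)%N ->
  (P [set w | exists i, (height N < X N i w)%R] <=
    (C * N%:R `^ (- (b * (alpha / t) - r)))%:E)%E.
Proof.
move=> TC N0; have [n1 nN _] := group_countP r_gt0 N0.
have m0 := group_size_gt0 r_gt0 r_lt1 N0.
have C0 : 0 <= C.
  by have := TC 1 ltr01; rewrite powR1 mulr1; apply: le_trans; have /andP[] := T01 1.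
pose A := [set w | forall i, X N i w <= height N].
have PA : P A = (((1 - T (height N)) ^+ m N) ^+ n N)%:E.
  rewrite (X_indep N (fun=> height N) N0); congr (_%:E).
  under eq_bigr do rewrite X_cdf//=.
  by rewrite prodr_const card_ord.
have mA : measurable A := below_measurable N (height N).
rewrite exceedE -/A.
rewrite probability_setC// PA -EFinB lee_fin.
set v := 1 - (1 - T (height N)) ^+ m N.
have v01 : 0 <= v <= 1 by exact: onem_expn_itv01.
rewrite (_ : (1 - T (height N)) ^+ m N = 1 - v); last by rewrite /v subKr.
apply: le_trans (onem_exp_onem_le (n N) v01) _.
have LN0 : 0 < L N by rewrite powR_gt0// ltr0n.
have vle : v <= C * N%:R `^ (- (b * (alpha / t))).
  apply: le_trans (max_tail_le (m N) alpha_gt0 t_gt0 LN0 T01 TC) _.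
  by rewrite -powRrM mulrN.
have /andP[v0 _] := v01.
apply: le_trans (ler_wpM2r v0 nN) _.
apply: le_trans (ler_wpM2l (powR_ge0 _ _) vle) _.
rewrite mulrCA ler_wpM2l// -powRD ?pnatr_eq0 -?lt0n ?N0 ?implybT//.
by rewrite opprB.
Qed.

Let lambdaL_cvg0 : lambda N * L N @[N --> \oo] --> 0.
Proof.
have ab : 0 < a - b by rewrite /a /b; have := b0_lt; lra.
have := cvg_comp _ _ (@cvgr_idn R) (powR_cvgy0 ab).
apply: cvg_trans; apply: near_eq_cvg; near=> N.
rewrite /= /lambda /L -powRD; first by congr (_ `^ _); ring.
apply/implyP => _; rewrite pnatr_eq0 -lt0n; near: N; exact: nbhs_infty_gt.
Unshelve. all: by end_near. Qed.

(** Both smallness conditions of [truncated_deviation] follow from lambda L tending to 0, the second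
    because [mu] converges and so stays bounded. *)
Let deviation_prob eps : 0 < eps ->
  \forall N \near \oo, (P [set w | (eps <= `|avg N w - mu N|)%R] <=
    (2 * expR (- ((n N)%:R * lambda N * (eps / 2))))%:E)%E.
Proof.
move=> e0.
have h1 : lambda N * L N * mu N @[N --> \oo] --> 0.
  by rewrite -[X in _ --> X](mul0r limit); exact: cvgM.
near=> N.
have N0 : (0 < N)%N by near: N; exact: nbhs_infty_gt.
have [n1 _ _] := group_countP r_gt0 N0.
apply: (truncated_deviation n1 (L := L N)) => //.
- by move=> y; exact: X_indep.
- by move=> i; exact: phi_mean.
- by rewrite powR_gt0// ltr0n.
- by near: N; apply: (cvgr_le _ lambdaL_cvg0); rewrite invr_gt0.
- by near: N; apply: (cvgr_le _ h1); rewrite divr_gt0.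
Unshelve. all: by end_near. Qed.

Let exp_decay eps : 0 < eps -> exists2 K, 0 <= K & forall N, (0 < N)%N ->
  expR (- ((n N)%:R * lambda N * (eps / 2))) <= K * N%:R `^ (- 2).
Proof.
move=> e0; pose delta := r - a.
have delta0 : 0 < delta by rewrite /delta /a; have := b0_lt; lra.
(* Chosen so that delta (k + 1) >= 2, which brings N^(- delta (k + 1)) below N^(-2). *)
pose k := Num.truncn (2 / delta).
have k2 : 2 <= delta * k.+1%:R.
  by rewrite mulrC -ler_pdivrMr// ltW// truncnS_gt.
(* The 4 is the 2 of eps / 2 times the rounding loss N^r <= 2 n. *)
exists ((k.+1)`!%:R * (eps / 4) ^- k.+1).
  by rewrite mulr_ge0// invr_ge0 exprn_ge0// divr_ge0// ltW.
move=> N N0; have [n1 _ Nn] := group_countP r_gt0 N0.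
have NR0 : 0 < N%:R :> R by rewrite ltr0n.
have x0 : 0 < eps / 4 * N%:R `^ delta by rewrite mulr_gt0 ?divr_gt0 ?powR_gt0.
apply: (@le_trans _ _ (expR (- (eps / 4 * N%:R `^ delta)))).
  rewrite ler_expR lerN2.
  have -> : N%:R `^ delta = N%:R `^ r * lambda N.
    by rewrite /lambda -powRD ?(gt_eqF NR0) ?implybT.
  have l0 : 0 <= lambda N := powR_ge0 _ _.
  have := ler_wpM2r (mulr_ge0 l0 (ltW e0)) Nn; lra.
apply: le_trans (expRN_le_powR k x0) _.
rewrite -[leRHS]mulrA ler_wpM2l// exprMn invfM.
rewrite ler_wpM2l ?invr_ge0 ?exprn_ge0 ?divr_ge0 ?(ltW e0)//.
rewrite -powR_mulrn ?powR_ge0// -powRrM -powRN ler_powR ?ler1n//.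
by rewrite lerN2.
Qed.

Let bad_summable eps : 0 < eps -> exists K p, [/\ 0 <= K, 1 < p &
  \forall N \near \oo, (P (bad eps N) <= (K * N%:R `^ (- p))%:E)%E].
Proof.
move=> e0; have [C C0 TC] := tail_bound.
have [K K0 HK] := exp_decay eps e0.
pose p1 := b * (alpha / t) - r.
exists (C + 2 * K), (Num.min p1 2); split.
- by rewrite addr_ge0 ?mulr_ge0// ltW.
- rewrite lt_min; apply/andP; split; last by rewrite ltr1n.
  (* [p1] > 1 is exactly b > b0. *)
  rewrite /p1 ltrBrDl -ltr_pdivrMr ?divr_gt0// invf_div.
  rewrite [X in X < _]mulrC [r + 1]addrC -/b0.
  by rewrite /b; have := b0_lt; lra.
near=> N.
have N0 : (0 < N)%N by near: N; exact: nbhs_infty_gt.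
have mono q : Num.min p1 2 <= q -> N%:R `^ (- q) <= N%:R `^ (- Num.min p1 2) :> R.
  by move=> pq; rewrite ler_powR ?ler1n// lerN2.
apply: le_trans (measureU2 _ _ _) _.
- by rewrite exceedE; apply: measurableC; exact: below_measurable.
- exact: deviation_measurable.
rewrite mulrDl EFinD; apply: leeD.
  apply: le_trans (exceed_prob C N TC N0) _; rewrite lee_fin ler_wpM2l ?(ltW C0)//.
  by apply: mono; rewrite ge_min lexx.
apply: le_trans (_ : _ <= (2 * expR (- ((n N)%:R * lambda N * (eps / 2))))%:E)%E _.
  by near: N; exact: deviation_prob.
rewrite lee_fin -[leRHS]mulrA ler_wpM2l//; apply: le_trans (HK N N0) _.
by rewrite ler_wpM2l// mono// ge_min lexx orbT.
Unshelve. all: by end_near. Qed.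

Let mean N w := (n N)%:R^-1 * \sum_i (X N i w / (m N)%:R `^ alpha^-1) `^ t.

(** Off the bad event no group maximum exceeds [height N], so the truncation is inactive and the
    true average equals [avg]. *)
Let good_mean eps N w : (0 < N)%N -> ~ bad eps N w -> `|mean N w - mu N| < eps.
Proof.
move=> N0 /not_orP[/forallNP below /negP]; rewrite -ltNge.
suff -> : mean N w = avg N w by [].
congr (_ * _); apply: eq_bigr => i _; rewrite /phi; apply/esym/min_idPl.
have m0 : 0 < (m N)%:R `^ alpha^-1 :> R.
  by rewrite powR_gt0// ltr0n; exact: group_size_gt0.
have LE : L N = (L N `^ t^-1) `^ t.
  by rewrite -powRrM mulVf ?gt_eqF// powRr1// powR_ge0.
rewrite LE; apply: (ge0_ler_powR (ltW t_gt0)); rewrite ?nnegrE ?powR_ge0//.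
  by rewrite divr_ge0 ?X_ge0// ltW.
by rewrite ler_pdivrMr// leNgt; apply/negP; exact: below.
Qed.

Let mean_cvg : {ae P, forall w, mean N w @[N --> \oo] --> limit}.
Proof.
(* Restricting to the thresholds 1/(k + 1) leaves countably many null sets, so one null set serves
   every eps. *)
have aegood : {ae P, forall w, forall k : nat, \forall N \near \oo, ~ bad k.+1%:R^-1 N w}.
  apply: ae_foralln => k.
  have k0 : 0 < k.+1%:R^-1 :> R by rewrite invr_gt0 ltr0n.
  have [K [p [K0 p1 HK]]] := bad_summable _ k0.
  exact: (borel_cantelli_powR (bad_measurable k.+1%:R^-1) K0 p1 HK).
apply: filterS aegood => w good.
apply/cvgrPdist_lt => eps e0.
have e2 : 0 < eps / 2 by rewrite divr_gt0.
have [k ke] : exists k : nat, k.+1%:R^-1 < eps / 2.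
  exists (Num.truncn (eps / 2)^-1); rewrite -[ltRHS]invrK ltf_pV2 ?posrE ?invr_gt0 ?ltr0n//.
  exact: truncnS_gt.
near=> N.
have N0 : (0 < N)%N by near: N; exact: nbhs_infty_gt.
have h1 : `|mean N w - mu N| < k.+1%:R^-1.
  by apply: good_mean => //; near: N; exact: good.
have h2 : `|limit - mu N| < eps / 2.
  by near: N; move/cvgrPdist_lt : mu_cvg; apply.
apply: le_lt_trans (ler_distD (mu N) _ _) _; rewrite (distrC (mu N)).
by rewrite [ltRHS]splitr; apply: ltrD => //; exact: lt_trans h1 ke.
Unshelve. all: by end_near. Qed.

Lemma sigma_hat_cvg : {ae P, forall w,
  (fun N => sigma_hat (group_size r N) alpha t (fun k => xi k w) (G N) - c)
    @ \oo --> (0 : R)}.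
Proof.
apply: filterS mean_cvg => w hw.
have s01 : 0 < t / alpha < 1 by rewrite s_gt0 ltr_pdivrMr// mul1r.
have G0 := Gamma_gt0 s01.
have hatE N : sigma_hat (group_size r N) alpha t (fun k => xi k w) (G N) =
    ((Gamma (1 - t / alpha))^-1 * mean N w) `^ (alpha / t).
  by rewrite /sigma_hat invfM -mulrA mulrCA mulrA.
have cE : ((Gamma (1 - t / alpha))^-1 * limit) `^ (alpha / t) = c.
  rewrite /limit mulrCA mulVf ?gt_eqF// mulr1 -powRrM.
  by rewrite -[alpha / t]invf_div mulfV ?gt_eqF// powRr1.
have hat_cvg : ((Gamma (1 - t / alpha))^-1 * mean N w) `^ (alpha / t)
    @[N --> \oo] --> c.
  rewrite -[c]cE; apply: cvg_powR; first by rewrite divr_gt0.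
    move=> N; rewrite mulr_ge0 ?invr_ge0 ?(ltW G0)// /mean mulr_ge0 ?invr_ge0//.
    by apply: sumr_ge0 => i _; exact: powR_ge0.
  by apply: cvgM => //; exact: cvg_cst.
rewrite (_ : (fun N => _) = fun N =>
    ((Gamma (1 - t / alpha))^-1 * mean N w) `^ (alpha / t) - c).
  by rewrite -(subrr c); apply: cvgB => //; exact: cvg_cst.
by apply/funext => N; rewrite hatE.
Qed.

End sigma_hat_consistency.

Unset Implicit Arguments.

(* xi 0 is the generic vector; the sample of size N is xi 1, ..., xi N. *)
Theorem theorem2p3 (R : realType) (d : nat)
    (d0 : measure_display) (Omega : measurableType d0) (P : probability Omega R)
    (alpha : R) (alpha_gt0 : 0 < alpha)
    (sigma : {finite_measure set (borel (usphere R d)) -> \bar R})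
    (xi : nat -> {RV P >-> borel 'rV[R]_d.+1})
    (xi_iid : iid xi)
    (xi_tail : regularly_varying_tail P (xi 0%N) alpha sigma)
    (r : R) (r_gt0 : 0 < r) (r_lt1 : r < 1)
    (G : forall N : nat, 'I_(group_count r N) -> {set 'I_N})
    (G_grouping : forall N : nat, is_grouping (group_size r N) (G N))
    (t : R) (t_gt0 : 0 < t) (t_lt : t < alpha * r / 2) :
  {ae P, forall w : Omega,
    (fun N : nat =>
       sigma_hat (group_size r N) alpha t (fun k => xi k w) (G N)
       - fine (sigma setT)) @ \oo --> (0 : R)}.
Proof.
exact: (@sigma_hat_cvg R d d0 Omega P alpha alpha_gt0 sigma xi xi_iid xi_tail r r_gt0
  r_lt1 G G_grouping t t_gt0 t_lt).
Qed.
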